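(* Let $U,b$ be strictly positive rationals, $T\ge 1$ an integer, and $\mu,x_0\in[0,U]_{\mathcal Q}$. With the notation of the context: (1) For all integers $t\in[1,T]$ and all $x,d\in[0,U]_{\mathcal Q}$, $\max\big(x,\chi^t_{\mathbf{MAR}}(d,U,b)\big)\in\hat\Phi^t(x,d)$. An optimal policy $\hat\pi^*=(\hat x^*_1,\dots,\hat x^*_T)$ for the problem $$\inf_{\pi\in\Pi}\ \sup_{Q\in\mathbf{MAR}_T}\mathbb E_Q\Big[\sum_{t=1}^T C^\pi_t\Big]\qquad(\mathrm P)$$ is given by $\hat x^*_1=\max\big(x_0,\chi^T_{\mathbf{MAR}}(\mu,U,b)\big)$ and, for $t\in[1,T-1]$, $$\hat x^*_{t+1}(\mathbf d_{[t]})=\max\big(\hat x^*_t(\mathbf d_{[t-1]})-d_t,\ \chi^{T-t}_{\mathbf{MAR}}(d_t,U,b)\big).$$ (2) For all integers $t\in[1,T]$ and all $x,d\in[0,U]_{\mathcal Q}$, $\mathfrak q^t_{x,d}\in\hat Q^t(x,d)$. A worst-case (at optimality) distribution $\hat Q^*\in\operatorname{argmax}_{Q\in\mathbf{MAR}_T}\mathbb E_Q[\sum_{t=1}^T C^{\hat\pi^*}_t]$ is given by $\hat Q^*_1=\mathfrak q^T_{\hat x^*_1,\mu}$ and, for $t\in[1,T-1]$ and every $\mathbf d\in\operatorname{supp}(\hat Q^*_{[t]})$, $$\hat Q^*_{t+1|\mathbf d}=\mathfrak q^{T-t}_{\hat x^*_{t+1}(\mathbf d),d_t}.$$ (3) If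 $x_0\le\beta^T_\mu$, then the optimal value of (P) equals $\mathrm{Opt}^T_{\mathbf{MAR}}(\mu,U,b)$.
   Context: Inventory model. $[0,U]_{\mathcal Q}=[0,U]\cap\mathbb Q$; intervals of time/index variables denote integer intervals; $z_+=\max(z,0)$; $C(x,d)=b(d-x)_++(x-d)_+$. For a vector $\mathbf d$, $\mathbf d_{[s]}=(d_1,\dots,d_s)$ ($\mathbf d_{[0]}$ is empty). An admissible policy $\pi$ is a vector $(x^\pi_1,\dots,x^\pi_T)$ where $x_1^\pi$ is a rational constant with $x_1^\pi\ge y_1^\pi:=x_0$, and for $t\ge2$, $x^\pi_t:[0,U]_{\mathcal Q}^{t-1}\to\mathbb Q$ satisfies $x^\pi_{t}(\mathbf d)\ge y^\pi_{t}(\mathbf d):=x^\pi_{t-1}(\mathbf d_{[t-2]})-d_{t-1}$ for all $\mathbf d\in[0,U]_{\mathcal Q}^{t-1}$. $\Pi$ is the set of admissible policies with all values $x^\pi_t(\cdot)\in[0,U]$. The cost in period $t$ is $C^\pi_t=C(x^\pi_t(D_{[t-1]}),D_t)$, where $D=(D_1,\dots,D_T)$ is the demand vector. For $m\in[0,U]_{\mathcal Q}$, $\mathfrak M(m)$ is the set of probability measures on $[0,U]_{\mathcal Q}$ with mean $m$. $\mathbf{MAR}_T$ is the set of probability measures $Q$ on $[0,U]_{\mathcal Q}^T$ such that $(D_1,\dots,D_T)\sim Q$ is a martingale and each marginal law lies in $\mathfrak M(\mu)$. For such $Q$: $Q_{[t]}$ is the law of $(D_1,\dots,D_t)$, $Q_1$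 the law of $D_1$, $\operatorname{supp}(Q_{[t]})$ is the set of points with strictly positive mass, and $Q_{t+1|\mathbf d}$ is the conditional law of $D_{t+1}$ given $D_{[t]}=\mathbf d$. Dynamic program. $\hat f^1(x,d)=C(x,d)$ and, for $t\ge2$, $\hat f^t(x,d)=C(x,d)+\hat V^{t-1}(x-d,d)$. For $t\ge1$: $\hat g^t(x,m)=\sup_{Q\in\mathfrak M(m)}\sum_{q\in[0,U]_{\mathcal Q}}\hat f^t(x,q)Q(q)$, $\hat V^t(y,m)=\inf_{z\ge y,\,z\in[0,U]_{\mathcal Q}}\hat g^t(z,m)$, $\hat Q^t(x,m)=\operatorname{argmax}_{Q\in\mathfrak M(m)}\sum_q\hat f^t(x,q)Q(q)$, $\hat\Phi^t(y,m)=\operatorname{argmin}_{z\ge y,\,z\in[0,U]_{\mathcal Q}}\hat g^t(z,m)$ (argmax/argmin denote sets of optimizers). Explicit quantities (for each integer $T\ge1$; empty products equal 1). For $j\in[-1,T-1]$, $A^T_j=U\prod_{k=j+1}^{T-1}\frac{k}{b+k}$, and $A^T_T=\frac{b+T}{T}U$; for $j\in[-1,T]$, $B^T_j=\frac{j}{b+T}A^T_j$. (So $A^T_{-1}=B^T_{-1}=B^T_0=0$ and $A^T_{T-1}=B^T_T=U$.) For $j\in[0,T]$, $G^T_j(x,\mu)=\big(T-\frac{b+T}{A^T_j}\mu\big)x+(T-j)b\mu$. $\Gamma^T_\mu=0$ if $\mu=0$, and $\Gamma^T_\mu=j+1$ if $\mu\in(A^{T+1}_j,A^{T+1}_{j+1}]$,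 $j\in[-1,T-1]$. $\chi^T_{\mathbf{MAR}}(\mu,U,b)=\beta^T_\mu=B^T_{\Gamma^T_\mu}$ and $\mathrm{Opt}^T_{\mathbf{MAR}}(\mu,U,b)=G^T_{\Gamma^T_\mu}(\beta^T_\mu,\mu)$. For $x,\mu\in[0,U]$, $\mathfrak q^T_{x,\mu}$ is the probability measure given by: (i) if $\mu\in(A^T_j,A^T_{j+1}]$ and $x\in[0,B^T_{j+1})$: $\mathfrak q^T_{x,\mu}(A^T_j)=\frac{A^T_{j+1}-\mu}{A^T_{j+1}-A^T_j}$, $\mathfrak q^T_{x,\mu}(A^T_{j+1})=\frac{\mu-A^T_j}{A^T_{j+1}-A^T_j}$; (ii) if $\mu\in(A^T_j,A^T_{j+1}]$ and $x\in[B^T_k,B^T_{k+1})$ with $k\ge j+1$: $\mathfrak q^T_{x,\mu}(0)=1-\frac{\mu}{A^T_k}$, $\mathfrak q^T_{x,\mu}(A^T_k)=\frac{\mu}{A^T_k}$; (iii) if $\mu=0$ or $x=U$: $\mathfrak q^T_{x,\mu}(0)=1-\frac{\mu}{U}$, $\mathfrak q^T_{x,\mu}(U)=\frac{\mu}{U}$. *)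

(* Defs.v *)
From HB Require Import structures.
From mathcomp Require Import all_boot all_order all_algebra.
From mathcomp Require Import all_classical all_reals all_analysis.
Set Implicit Arguments.
Unset Strict Implicit.
Unset Printing Implicit Defensive.
Import Order.TTheory GRing.Theory Num.Theory.
Local Open Scope classical_set_scope.
Local Open Scope ring_scope.

(* Conventions.  MathComp-Analysis, over an arbitrary R : realType.  Demands,
   inventory levels and parameters are rationals; probabilities and expectations
   live in R and \bar R.  Periods are numbered from 1, as in the mathematics:
   d_t is [coord t d] and d_[s] is [take s d].  A measure on [0,U]_Q (resp.
   [0,U]_Q^T) is a measure on rat (resp. T.-tuple rat) concentrated on it. *)

HB.instance Definition _ := @isMeasurable.Build default_measure_display
  rat discrete_measurable discrete_measurable0
  discrete_measurableC discrete_measurableU.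

(* The product sigma-algebra on rational vectors is discrete too. *)
Lemma measurable_rat_tuple (n : nat) (A : set (n.-tuple rat)) : measurable A.
Proof.
have m1 (x : n.-tuple rat) : measurable [set x].
  rewrite (_ : [set x] =
      \bigcap_(i in [set: 'I_n]) ((fun y => tnth y i) @^-1` [set tnth x i])).
    apply: fin_bigcap_measurable => [|i _]; first exact: finite_finset.
    by rewrite -[X in measurable X]setTI; exact: measurable_tnth.
  apply/seteqP; split => [y -> i _ //|y /= h].
  by apply: eq_from_tnth => i; exact: h.
apply: countable_measurable => //; exact: countableP.
Qed.

Definition argmin_set {I : Type} {R : realType} (S : set I) (f : I -> \bar R) :
  set I := [set z | S z /\ forall w, S w -> (f z <= f w)%E].

Definition argmax_set {I : Type} {R : realType} (S : set I) (f : I -> \bar R) :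
  set I := [set z | S z /\ forall w, S w -> (f w <= f z)%E].

Definition ratI (U : rat) : set rat := [set q | 0 <= q <= U].

Definition coord (t : nat) (d : seq rat) : rat := d`_(t.-1).

Definition box (U : rat) (n : nat) : set (n.-tuple rat) :=
  [set d | forall t, (1 <= t <= n)%N -> ratI U (coord t d)].

Arguments box : clear implicits.

Definition coordT (T t : nat) (D : T.-tuple rat) : rat := coord t D.

Lemma measurable_coordT (T t : nat) :
  measurable_fun [set: T.-tuple rat] (@coordT T t).
Proof. by move=> _ Y _; exact: measurable_rat_tuple. Qed.

HB.instance Definition _ (T t : nat) :=
  isMeasurableFun.Build _ _ (T.-tuple rat) rat (@coordT T t)
    (@measurable_coordT T t).

Definition marginal {R : realType} (T : nat)
    (Q : probability (T.-tuple rat) R) (t : nat) : probability rat R :=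
  distribution Q (@coordT T t).

(* Q_[t]({d}), the mass of the point d under the law of (D_1, ..., D_t). *)
Definition prefix_mass {R : realType} (T : nat)
    (Q : probability (T.-tuple rat) R) (t : nat) (d : t.-tuple rat) : \bar R :=
  Q [set D | take t D = d :> seq rat].

Definition supp {R : realType} (T : nat)
    (Q : probability (T.-tuple rat) R) (t : nat) : set (t.-tuple rat) :=
  [set d | (0 < prefix_mass Q d)%E].

Arguments supp {R} T Q t.

(* Q_{t+1|d}, meaningful when d has positive mass. *)
Definition cond_law {R : realType} (T : nat)
    (Q : probability (T.-tuple rat) R) (t : nat) (d : t.-tuple rat)
    (A : set rat) : \bar R :=
  (fine (Q [set D | take t D = d :> seq rat /\ A (coord t.+1 D)])
   / fine (prefix_mass Q d))%:E.

Definition fM {R : realType} (U m : rat) : set (probability rat R) :=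
  [set Q : probability rat R | Q (ratI U) = 1%E /\
           (\int[Q]_(q in ratI U) (ratr q : R)%:E)%E = (ratr m : R)%:E].

(* E[D_{t+1} | D_[t]] = D_t, with conditional expectation unfolded: both sides
   have the same integral over each event {D_[t] \in B} of sigma(D_[t]). *)
Definition martingale {R : realType} (T : nat)
    (Q : probability (T.-tuple rat) R) : Prop :=
  forall (t : nat) (B : set (t.-tuple rat)), (1 <= t < T)%N ->
    let E := [set D : T.-tuple rat | exists2 d, B d & take t D = d :> seq rat] in
    (\int[Q]_(D in E) (ratr (coord t.+1 D) : R)%:E
     = \int[Q]_(D in E) (ratr (coord t D) : R)%:E)%E.

Definition MAR {R : realType} (U mu : rat) (T : nat) :
    set (probability (T.-tuple rat) R) :=
  [set Q : probability (T.-tuple rat) R | [/\ Q (box U T) = 1%E, martingale Q &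
    forall t, (1 <= t <= T)%N -> fM U mu (marginal Q t)]].

Arguments MAR : clear implicits.

Definition C (b x d : rat) : rat := b * Num.max (d - x) 0 + Num.max (x - d) 0.

(* [pi t d] is x^pi_t(d), for d of length t-1; other arguments are never used. *)
Definition policy : Type := nat -> seq rat -> rat.

Definition admissible (U x0 : rat) (T : nat) (pi : policy) : Prop :=
  pi 1%N [::] >= x0 /\
  forall (t : nat) (d : t.-1.-tuple rat), (2 <= t <= T)%N -> box U t.-1 d ->
    pi t d >= pi t.-1 (take t.-2 d) - coord t.-1 d.

Definition Pi (U x0 : rat) (T : nat) : set policy :=
  [set pi | admissible U x0 T pi /\
    forall (t : nat) (d : t.-1.-tuple rat), (1 <= t <= T)%N -> box U t.-1 d ->
      ratI U (pi t d)].

Definition total_cost (b : rat) (T : nat) (pi : policy) (D : T.-tuple rat) : rat :=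
  \sum_(1 <= t < T.+1) C b (pi t (take t.-1 D)) (coord t D).

Definition expected_cost {R : realType} (b : rat) (T : nat) (pi : policy)
    (Q : probability (T.-tuple rat) R) : \bar R :=
  'E_Q[fun D => ratr (total_cost b pi D)].

Definition worst_cost (R : realType) (U b mu : rat) (T : nat) (pi : policy) :
    \bar R :=
  ereal_sup [set expected_cost b pi Q | Q in MAR R U mu T].

Definition P_value (R : realType) (U b mu x0 : rat) (T : nat) : \bar R :=
  ereal_inf [set worst_cost R U b mu T pi | pi in Pi U x0 T].

Definition feasible (U y : rat) : set rat := [set z | y <= z /\ ratI U z].

Definition g_of {R : realType} (U : rat) (f : rat -> rat -> \bar R) (x m : rat) :
    \bar R :=
  ereal_sup [set (\int[Q]_(q in ratI U) f x q)%E | Q in fM U m].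

Definition V_of {R : realType} (U : rat) (f : rat -> rat -> \bar R) (y m : rat) :
    \bar R :=
  ereal_inf [set g_of U f z m | z in feasible U y].

(* Only t >= 1 is meaningful. *)
Fixpoint fhat (R : realType) (U b : rat) (t : nat) (x d : rat) {struct t} :
    \bar R :=
  match t with
  | 0%N => 0%E
  | t'.+1 => ((ratr (C b x d) : R)%:E +
      if t' is 0%N then 0 else V_of U (fhat R U b t') (x - d)%R d)%E
  end.

Definition ghat (R : realType) (U b : rat) (t : nat) (x m : rat) : \bar R :=
  g_of U (fhat R U b t) x m.

Definition Qhat (R : realType) (U b : rat) (t : nat) (x m : rat) :
    set (probability rat R) :=
  argmax_set (fM U m) (fun Q => (\int[Q]_(q in ratI U) fhat R U b t x q)%E).

Arguments Qhat : clear implicits.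

Definition Phihat (R : realType) (U b : rat) (t : nat) (y m : rat) : set rat :=
  argmin_set (feasible U y) (fun z => ghat R U b t z m).

(* A^T_j, for -1 <= j <= T. *)
Definition Acoef (U b : rat) (T : nat) (j : int) : rat :=
  if j == T%:Z then (b + T%:R) / T%:R * U
  else U * \prod_(absz (j + 1)%R <= k < T) (k%:R / (b + k%:R)).

Definition Bcoef (U b : rat) (T : nat) (j : int) : rat :=
  j%:~R / (b + T%:R) * Acoef U b T j.

Definition Gfun (U b : rat) (T : nat) (j : int) (x mu : rat) : rat :=
  (T%:R - (b + T%:R) / Acoef U b T j * mu) * x + (T%:R - j%:~R) * b * mu.

(* i stands for j + 1. *)
Definition Gam (U b : rat) (T : nat) (mu : rat) : int :=
  if mu == 0 then 0
  else if [pick i : 'I_T.+1 |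
             Acoef U b T.+1 (i%:Z - 1) < mu <= Acoef U b T.+1 i%:Z] is Some i
  then i%:Z else 0.

Definition chi (U b : rat) (T : nat) (mu : rat) : rat :=
  Bcoef U b T (Gam U b T mu).

Definition Opt (U b : rat) (T : nat) (mu : rat) : rat :=
  Gfun U b T (Gam U b T mu) (chi U b T mu) mu.

Definition pick_atom (a a' : rat) (c : bool) : rat := if c then a' else a.

Lemma measurable_pick_atom (a a' : rat) :
  measurable_fun [set: bool] (pick_atom a a').
Proof. by []. Qed.

HB.instance Definition _ (a a' : rat) :=
  isMeasurableFun.Build _ _ bool rat (pick_atom a a')
    (measurable_pick_atom a a').

(* Mass p at a' and 1 - p at a. *)
Definition two_point (R : realType) (a a' p : rat) : probability rat R :=
  distribution (bernoulli_prob (ratr p : R)) (pick_atom a a').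

(* i stands for j + 1.  When 0 < U, 0 < b, 1 <= T and x, mu are in [0,U] the
   cases are exclusive and exhaustive, and the two None branches unreachable. *)
Definition qlaw (R : realType) (U b : rat) (T : nat) (x mu : rat) :
    probability rat R :=
  let A := Acoef U b T in
  let B := Bcoef U b T in
  if (mu == 0) || (x == U) then two_point R 0 U (mu / U)
  else if [pick i : 'I_T.+1 | A (i%:Z - 1) < mu <= A i%:Z] is Some i then
    if x < B i%:Z then
      two_point R (A (i%:Z - 1)) (A i%:Z)
        ((mu - A (i%:Z - 1)) / (A i%:Z - A (i%:Z - 1)))
    else if [pick k : 'I_T | (i <= k)%N && (B k%:Z <= x < B (k%:Z + 1))] is Some k
      then two_point R 0 (A k%:Z) (mu / A k%:Z)
      else two_point R 0 U (mu / U)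
  else two_point R 0 U (mu / U).

Fixpoint opt_policy (U b mu x0 : rat) (T t : nat) (d : seq rat) {struct t} : rat :=
  match t with
  | 0%N => 0
  | s.+1 =>
      if s is 0%N then Num.max x0 (chi U b T mu)
      else Num.max (opt_policy U b mu x0 T s (take s.-1 d) - coord s d)
                   (chi U b (T - s) (coord s d))
  end.

Definition worst_case_spec {R : realType} (U b mu x0 : rat) (T : nat)
    (Q : probability (T.-tuple rat) R) : Prop :=
  let xs := opt_policy U b mu x0 T in
  (forall A : set rat, marginal Q 1 A = qlaw R U b T (xs 1%N [::]) mu A) /\
  forall (t : nat) (d : t.-tuple rat), (1 <= t < T)%N -> supp T Q t d ->
    forall A : set rat,
      cond_law Q d A = qlaw R U b (T - t) (xs t.+1 d) (coord t d) A.

(* Main.v *)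
Require Import Defs.
From HB Require Import structures.
From mathcomp Require Import all_boot all_order all_algebra.
From mathcomp Require Import all_classical all_reals all_analysis.
From mathcomp Require Import ring lra.
Set Implicit Arguments.
Unset Strict Implicit.
Unset Printing Implicit Defensive.
Import Order.TTheory GRing.Theory Num.Theory.
Local Open Scope classical_set_scope.
Local Open Scope ring_scope.

(** The dynamic program has a closed form, because each of its stages is
governed by two families of affine functions of the demand.

Write f_t, g_t, V_t for the functions of the dynamic program with t periods to
go.  The supremum over all laws of mean m makes g_t(x, .) the concave envelope
of f_t(x, .) on [0, U], so g_t is known as soon as f_t(x, .) is squeezed
between its values at a few demands and the chords through them.  The relevant
demands are 0 and the break points A_k.  The chords are G_k(x, .) through 0
and A_k ([Gfun]) and H_i(x, .) through A_(i-1) and A_i ([Hfun]).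
 - Above: G_k(x, .) majorizes f_t(x, .) when B_k <= x <= B_(k+1)
   ([cost_le_G_all]), and H_i(x, .) does so when x <= B_i ([cost_le_H_all]).
   This goes by induction on t.  As V_t is an infimum over order levels, one
   well-chosen level bounds it; which one works depends on the position of the
   order and of the demand, and each case is a polynomial inequality in the
   ratios x / A_k and d / A_k ([scale_over], [scale_under]).
 - Below: f_t(x, .) is at least the chord value at 0 and at each A_k
   ([cost_ge_all]), again by induction.
A majorizing chord bounds the integral of f_t(x, .) by its value at the mean,
and the two-point law on its end points reaches that value; this is why q is
optimal ([qlaw_optimal]).  In x, the chord G_k has slope t - (b + t) m / A^t_k,
which changes sign exactly at m = A^(t+1)_k, so the minimum over x sits at the
base-stock level chi ([chi_optimal]).

For the multiperiod problem, consider the cost paid in the first t periods plus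
V_(T-t) at the current state ([value]).  Under the base-stock policy its
expectation does not increase in t, whatever the martingale law: given the past,
the next cost lies below an affine function of the next demand, and the
martingale property evaluates that function at the current demand
([value_step_le]).  Under an arbitrary policy its expectation does not decrease
if each demand is drawn from the law q of the dynamic program
([value_step_ge]).  Such a law exists for every policy ([markov_exists]) and is
a martingale law with the right marginals ([mean_preserving_MAR]).  Hence
V_T(x_0, mu) is both the cost that the base-stock policy guarantees and a cost
that nature can force against any policy, which gives the optimal policy, the
worst-case law and the value at once. *)

(** * The break points A and B *)

Section Breakpoints.
Variables U b : rat.
Hypotheses (U_gt0 : 0 < U) (b_gt0 : 0 < b).
Implicit Types n i k : nat.

Let bn_gt0 n : 0 < b + n%:R.
Proof. by rewrite ltr_wpDr ?ler0n. Qed.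

Lemma Acoef_last n : Acoef U b n.+1 n%:Z = U.
Proof.
rewrite /Acoef eqz_nat ltn_eqF// big_geq ?mulr1//=.
by rewrite addn1.
Qed.

Lemma Acoef_top n : Acoef U b n n%:Z = (b + n%:R) / n%:R * U.
Proof. by rewrite /Acoef eqxx. Qed.

Lemma Acoef_predE n i : Acoef U b n (i.+1%:Z - 1) = Acoef U b n i%:Z.
Proof. by rewrite -addn1 PoszD addrK. Qed.

Lemma Acoef_pred n i : (i <= n.+1)%N ->
  Acoef U b n.+1 (i%:Z - 1) = i%:R / (b + i%:R) * Acoef U b n.+1 i%:Z.
Proof.
case: i => [|i] ilen.
  rewrite mul0r mul0r /Acoef sub0r.
  by rewrite /= big_nat_recl// !mul0r mulr0.
rewrite Acoef_predE; have := ilen; rewrite ltnS leq_eqVlt => /predU1P[->|iltn].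
  rewrite Acoef_last Acoef_top; field.
  by rewrite nat1r pnatr_eq0/= gt_eqF.
rewrite /Acoef !eqz_nat eqSS !ltn_eqF//.
rewrite /= !addn1 (@big_ltn _ _ _ i.+1)//.
by rewrite mulrCA mulrA.
Qed.

Lemma Acoef_rec n i : (i <= n)%N ->
  i.+1%:R * Acoef U b n.+1 i.+1%:Z = (b + i.+1%:R) * Acoef U b n.+1 i%:Z.
Proof.
move=> iln; rewrite -(Acoef_predE n.+1 i) Acoef_pred//; field.
by rewrite nat1r gt_eqF.
Qed.

Lemma Acoef_gt0 n i : (i <= n.+1)%N -> 0 < Acoef U b n.+1 i%:Z.
Proof.
move=> ilen; rewrite -(subKn ilen).
elim: (n.+1 - i)%N => [|m IH].
  by rewrite subn0 Acoef_top mulr_gt0// divr_gt0// ?ltr0n.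
case: (leqP n.+1 m) => [nm|mn].
  by move: IH; rewrite (eqP nm) (eqP (leqW nm)).
have -> : (n.+1 - m.+1)%:Z = (n.+1 - m)%:Z - 1 :> int.
  by rewrite subnS predn_int// subn_gt0.
rewrite Acoef_pred ?leq_subr// mulr_gt0// divr_gt0//.
by rewrite ltr0n subn_gt0.
Qed.

(** The break points at which chi switches, those of the horizon increased by
one, are those of the current horizon shrunk by a common factor. *)
Lemma Acoef_step n i : (i <= n.+1)%N ->
  Acoef U b n.+2 i%:Z = n.+1%:R / (b + n.+1%:R) * Acoef U b n.+1 i%:Z.
Proof.
rewrite leq_eqVlt => /predU1P[->|iltn].
  rewrite Acoef_last Acoef_top; field.
  by rewrite nat1r pnatr_eq0/= gt_eqF.
rewrite /Acoef !eqz_nat (ltn_eqF iltn) (ltn_eqF (leqW iltn)).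
by rewrite /= !addn1 big_nat_recr//= mulrA mulrC.
Qed.

Lemma Acoef_le n i j : (i <= j <= n)%N ->
  Acoef U b n.+1 i%:Z <= Acoef U b n.+1 j%:Z.
Proof.
case/andP; elim: j => [|j IH]; first by rewrite leqn0 => /eqP->.
rewrite leq_eqVlt => /predU1P[->//|ij jn].
apply: le_trans (IH ij (ltnW jn)) _.
rewrite -(Acoef_predE _ j) Acoef_pred; last exact: leqW.
apply: ler_piMl; first exact/ltW/Acoef_gt0/leqW.
by rewrite ler_pdivrMr// mul1r lerDr ltW.
Qed.

Lemma Bcoef_top n : Bcoef U b n.+1 n.+1%:Z = U.
Proof.
rewrite /Bcoef Acoef_top; field.
by rewrite nat1r pnatr_eq0/= gt_eqF.
Qed.

Lemma Bcoef0 n : Bcoef U b n 0 = 0.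
Proof. by rewrite /Bcoef !mul0r. Qed.

(** The lowest interval is open at A_(-1) = 0, so only a positive mean has a
bracket; the brackets up to the index n cover the rest because A_n = U. *)
Lemma Acoef_bracket n (m : rat) : 0 < m -> m <= U ->
  exists2 i, (i <= n)%N &
    Acoef U b n.+1 (i%:Z - 1) < m <= Acoef U b n.+1 i%:Z.
Proof.
move=> m0 mU; have exP : exists i, m <= Acoef U b n.+1 i%:Z.
  by exists n; rewrite Acoef_last.
case: (ex_minnP exP) => i mi minP.
have ilen : (i <= n)%N by apply: minP; rewrite Acoef_last.
exists i => //; rewrite mi andbT;
  case: i mi minP ilen => [_ _ _|i mi minP ilen].
  by rewrite Acoef_pred// !mul0r.
by rewrite Acoef_predE ltNge; apply/negP => /minP; rewrite ltnn.
Qed.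

Lemma Bcoef_bracket n (x : rat) : 0 <= x -> x < U ->
  exists2 k, (k <= n)%N & Bcoef U b n.+1 k%:Z <= x < Bcoef U b n.+1 k.+1%:Z.
Proof.
move=> x0 xU; have exP : exists i, x < Bcoef U b n.+1 i%:Z.
  by exists n.+1; rewrite Bcoef_top.
case: (ex_minnP exP) => -[|k] xk minP.
  by move: xk; rewrite Bcoef0 ltNge x0.
exists k; first by rewrite -ltnS; apply: minP; rewrite Bcoef_top.
by rewrite xk andbT leNgt; apply/negP => /minP; rewrite ltnn.
Qed.

Lemma Bcoef_succ n k : (k <= n)%N ->
  Bcoef U b n.+1 k.+1%:Z =
    (b + k.+1%:R) / (b + n.+1%:R) * Acoef U b n.+1 k%:Z.
Proof.
move=> kn; rewrite -(Acoef_predE _ k) Acoef_pred// /Bcoef -pmulrn; field.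
by rewrite !nat1r !gt_eqF.
Qed.

Lemma Bcoef_nat n k :
  Bcoef U b n k%:Z = k%:R / (b + n%:R) * Acoef U b n k%:Z.
Proof. by []. Qed.

Lemma Bcoef_ge0 n k : (k <= n.+1)%N -> 0 <= Bcoef U b n.+1 k%:Z.
Proof.
move=> kn; rewrite Bcoef_nat mulr_ge0 ?divr_ge0 ?ler0n//; first exact/ltW.
exact/ltW/Acoef_gt0.
Qed.

Lemma Bcoef_le n i j : (i <= j <= n.+1)%N ->
  Bcoef U b n.+1 i%:Z <= Bcoef U b n.+1 j%:Z.
Proof.
case/andP; elim: j => [|j IH]; first by rewrite leqn0 => /eqP->.
rewrite leq_eqVlt => /predU1P[->//|ij jn].
apply: le_trans (IH ij (ltnW jn)) _; rewrite Bcoef_succ// Bcoef_nat.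
apply: ler_wpM2r; first exact/ltW/Acoef_gt0/ltnW.
apply: ler_wpM2r; first by rewrite invr_ge0 ltW.
by rewrite -[j.+1%:R]natr1; have := b_gt0; lra.
Qed.

Lemma Bcoef_leU n k : (k <= n.+1)%N -> Bcoef U b n.+1 k%:Z <= U.
Proof. by move=> kn; rewrite -{2}(Bcoef_top n) Bcoef_le// kn leqnn. Qed.

Lemma Acoef_leU n k : (k <= n)%N -> Acoef U b n.+1 k%:Z <= U.
Proof. by move=> kn; rewrite -{2}(Acoef_last n) Acoef_le// kn leqnn. Qed.

End Breakpoints.

(** * The inequalities of the induction step, in units of a break point *)

(** G_k for s + 1 periods, in units of the break point A_k: the order level is
u A_k and the demand is v A_k.

In the lemmas below, the left-hand side is the cost of the present period plus
a bound on the cost of the remaining s periods. That bound is either line i,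
((s-i)b - i) v + i A_i / A_k, the cost of raising the stock to the level B_i of
s periods, or a piece of g_s, the cost of leaving the stock at u - v. *)
Definition scaledG (b s k u v : rat) :=
  (s + 1 - (b + s + 1) * v) * u + (s + 1 - k) * b * v.

(** The slack is a product, (1 - v) ((b + s + 1) u - k). *)
Lemma scaled_line_above (b s k u v : rat) :
  k <= (b + s + 1) * u -> v <= 1 ->
  b * (v - u) + (((s - k) * b - k) * v + k) <= scaledG b s k u v.
Proof.
move=> u_lo v1; rewrite /scaledG.
have : 0 <= (1 - v) * ((b + s + 1) * u - k) by apply: mulr_ge0; lra.
lra.
Qed.

(** For demands beyond A_k the line k + 1 takes over; its constant (k + 1)
A_(k+1) equals (b + k + 1) A_k. *)
Lemma scaled_next_line_above (b s k u v : rat) :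
  (b + s + 1) * u <= b + k + 1 -> 1 <= v ->
  b * (v - u) + (((s - k - 1) * b - (k + 1)) * v + (b + k + 1))
    <= scaledG b s k u v.
Proof.
move=> u_hi v1; rewrite /scaledG.
have : 0 <= (v - 1) * (b + k + 1 - (b + s + 1) * u) by apply: mulr_ge0; lra.
lra.
Qed.

Lemma scaled_piece (b s k u v : rat) : 0 < b -> 0 <= s -> u <= 1 ->
  0 <= v -> v <= u ->
  (u - v) + ((s - s * v) * (u - v) + (s - k) * b * v) <= scaledG b s k u v.
Proof.
move=> b0 s0 u1 v0 vu; rewrite /scaledG.
have h1 : 0 <= v * ((b + s + 1) * (1 - u)).
  by apply: mulr_ge0 => //; apply: mulr_ge0; lra.
have h2 : 0 <= v * (s * (u - v)).
  by apply: mulr_ge0 => //; apply: mulr_ge0; lra.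
lra.
Qed.

(** The slack is affine in v. It is nonnegative at both ends of the range
u - k/s <= v <= u, where line k touches piece k and where the demand equals the
order level, hence throughout. *)
Lemma scaled_line_below (b s k u v : rat) : 0 < b -> 0 < s -> 0 <= k -> k <= s
  ->
  (b + s + 1) * u <= b + k + 1 ->
  k <= s * u -> v <= u -> s * (u - v) <= k ->
  (u - v) + (((s - k) * b - k) * v + k) <= scaledG b s k u v.
Proof.
move=> b0 s0 k0 ks u_hi ku vu vk; rewrite /scaledG.
have u1 : u <= 1.
  by rewrite -(@ler_pM2l _ (b + s + 1)); lra.
pose q := k / s; have kE : k = s * q by rewrite /q mulrC divfK// gt_eqF.
move: k0 ks ku vk u_hi; rewrite kE.
rewrite !(ler_pM2l s0) pmulr_rge0// => q0 qs qu vq u_hi.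
have q1 : q <= 1 by rewrite -(ler_pM2l s0) mulr1.
move: q0; rewrite le_eqVlt => /predU1P[q0|q0].
  have <- : u = v by lra.
  rewrite -q0; have : 0 <= (b + s + 1) * u * (1 - u).
    by apply: mulr_ge0; [apply: mulr_ge0|]; lra.
  lra.
have bsu : 0 <= (b + s + 1) * (u - q) by apply: mulr_ge0; lra.
have bq : 0 <= (b + 1) * q by apply: mulr_ge0; lra.
have Eu : (1 - u) * (s * q - (b + s + 1) * u) <= 0.
  by apply: mulr_ge0_le0; lra.
have Ep : (u - q) * ((b + 1) * q - (1 - (u - q)) * (b + s + 1)) <= 0.
  by apply: mulr_ge0_le0; lra.
rewrite -(ler_pM2l q0).
have h1 : (q - (u - v)) * ((1 - u) * (s * q - (b + s + 1) * u)) <= 0.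
  by apply: mulr_ge0_le0; lra.
have h2 : (u - v) * ((u - q) * ((b + 1) * q - (1 - (u - q)) * (b + s + 1))) <=
  0.
  by apply: mulr_ge0_le0; lra.
lra.
Qed.

(** The common core of the cases where the order level lies below the level B_k
of s periods: up to a positive factor, the excess of line k over G_k at
v = k/(b+k), that is, at the demand A_(k-1). *)
Lemma scaled_far (b s k u : rat) : 0 < b -> 0 < s -> 0 <= k -> k <= s ->
  0 <= u -> s * u <= k -> - k + u * (k - b * (s - k)) <= 0.
Proof.
move=> b0 s0 k0 ks u0 uk.
case: (lerP 0 (k - b * (s - k))) => h.
  rewrite -(ler_pM2l s0) mulr0.
  have : (s * u - k) * (k - b * (s - k)) <= 0 by apply: mulr_le0_ge0; lra.
  have : 0 <= k * (b * (s - k)) by apply: mulr_ge0 => //; apply: mulr_ge0; lra.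
  have : 0 <= k * (s - k) by apply: mulr_ge0; lra.
  lra.
have : u * (k - b * (s - k)) <= 0 by apply: mulr_ge0_le0; lra.
lra.
Qed.

(** Here v at least k/(b+k) means a demand at or beyond A_(k-1). *)
Lemma scaled_line_far (b s k u v : rat) : 0 < b -> 0 < s -> 0 <= k -> k <= s ->
  0 <= u -> (b + s + 1) * u <= b + k + 1 ->
  s * u <= k -> k <= (b + k) * v ->
  (u - v) + (((s - k) * b - k) * v + k) <= scaledG b s k u v.
Proof.
move=> b0 s0 k0 ks u0 u_hi uk vk; rewrite /scaledG.
have bk : 0 < b + k by lra.
have h1 : 0 <= (b + k + 1 - (b + s + 1) * u) * ((b + k) * v - k).
  by apply: mulr_ge0; lra.
have h2 := scaled_far b0 s0 k0 ks u0 uk.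
rewrite -(ler_pM2l bk).
lra.
Qed.

(** The lines k-1 and k meet at a = A_(k-1) / A_k, and the slack of line k-1
only grows as v moves down from a. *)
Lemma scaled_prev_line (b s k u v a : rat) :
  0 < b -> 0 < s -> 0 <= k -> k <= s -> (b + k) * a = k ->
  k <= (b + s + 1) * u -> 0 <= u -> (b + s + 1) * u <= b + k + 1 ->
  s * u <= k -> v <= a ->
  (u - v) + (((s - (k - 1)) * b - (k - 1)) * v + (k - 1) * a) <= scaledG b s k
    u v.
Proof.
move=> b0 s0 k0 ks ak u_lo u0 u_hi uk va.
have := @scaled_line_far b s k u a b0 s0 k0 ks u0 u_hi uk; rewrite ak /scaledG.
move=> /(_ (lexx _)).
have : 0 <= (a - v) * ((b + s + 1) * u - k) by apply: mulr_ge0; lra.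
lra.
Qed.

Lemma scaled_prev_piece (b s k u v a : rat) :
  0 < b -> 0 < s -> 0 <= k -> k <= s -> (b + k) * a = k -> 0 < a ->
  0 <= u -> s * u <= k -> 0 <= v -> v <= a ->
  (u - v) + ((s - s / a * v) * (u - v) + (s - (k - 1)) * b * v)
    <= scaledG b s k u v.
Proof.
move=> b0 s0 k0 ks ak a0 u0 uk v0 va; rewrite /scaledG.
have h := scaled_far b0 s0 k0 ks u0 uk.
have bk : 0 < b + k by lra.
have h1 : - a - s * u + (b + s + 1) * u * a <= 0.
  rewrite -(ler_pM2l bk) mulr0.
  have -> : (b + k) * (- a - s * u + (b + s + 1) * u * a) =
     - ((b + k) * a) - (b + k) * s * u + (b + s + 1) * u * ((b + k) * a) by
       ring.
  by rewrite ak; lra.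
have h2 : v * (- (s + 1) * a - s * (u - v) + (b + s + 1) * u * a) <= 0.
  apply: mulr_ge0_le0 => //.
  have : s * v <= s * a by rewrite ler_pM2l.
  lra.
rewrite -(ler_pM2l a0).
set w := s / a * v.
have aw : a * w = s * v by rewrite /w; field; rewrite gt_eqF.
have -> : a * (u - v + ((s - w) * (u - v) + (s - (k - 1)) * b * v)) =
 a * (u - v + (s * (u - v) + (s - (k - 1)) * b * v)) - a * w * (u - v) by ring.
rewrite aw.
lra.
Qed.

(** * Integrals over discrete spaces *)

Lemma discrete_measurable_fun d1 d2 (X : sigmaRingType d1) (Y : sigmaRingType
  d2)
    (mX : forall A : set X, measurable A) (D : set X) (f : X -> Y) :
  measurable_fun D f.
Proof. by move=> _ B _; exact: mX. Qed.

(** Conditioning on a countable variable, for two integrals at once: two spaces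
can be compared through the common values of h and k. *)
Lemma le_integral_fibers (R : realType) d1 d2 (X : measurableType d1)
    (Y : measurableType d2) (I : countType)
    (mX : forall A : set X, measurable A) (mY : forall A : set Y, measurable A)
    (mu : {measure set X -> \bar R}) (nu : {measure set Y -> \bar R})
    (D : set X) (E : set Y) (h : X -> I) (k : Y -> I)
    (f : X -> \bar R) (g : Y -> \bar R) :
  (forall x, D x -> (0 <= f x)%E) -> (forall y, E y -> (0 <= g y)%E) ->
  (forall i, (\int[mu]_(x in D `&` [set x | h x = i]) f x <=
              \int[nu]_(y in E `&` [set y | k y = i]) g y)%E) ->
  (\int[mu]_(x in D) f x <= \int[nu]_(y in E) g y)%E.
Proof.
move=> f0 g0 fg.
have fibE d (Z : measurableType d) (mZ : forall A : set Z, measurable A)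
    (m : {measure set Z -> \bar R}) (A : set Z) (l : Z -> I) (u : Z -> \bar R) :
    (forall z, A z -> (0 <= u z)%E) ->
  (\int[m]_(z in A) u z =
    \sum_(n <oo) \int[m]_(z in A `&` [set z | pickle (l z) = n]) u z)%E.
  move=> u0.
  have AE : A = \bigcup_n (A `&` [set z | pickle (l z) = n]).
    apply/seteqP; split => [z Az|z [n _ []//]].
    by exists (pickle (l z)).
  rewrite {1}AE ge0_integral_bigcup//.
  - by move=> z [n _ [Az _]]; exact: u0.
  - by apply/trivIsetP => i j _ _ /eqP ij; apply/seteqP;
    split => // z [[_ /= zi] [_ /= zj]]; case: ij; rewrite -zi -zj.
rewrite (fibE _ _ mX mu D h)// (fibE _ _ mY nu E k)//.
apply: lee_nneseries => [n _ _|n _].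
  by apply: integral_ge0 => x [Dx _]; exact: f0.
case En : (unpickle n : option I) => [i|]; last first.
  have nP d (Z : measurableType d) (l : Z -> I) A :
      A `&` [set z | pickle (l z) = n] = set0.
    by apply/seteqP; split => // z [_ /= lz]; move: En; rewrite -lz pickleK.
  by rewrite !nP !integral_set0.
have [ni|ni] := eqVneq (pickle i) n; last first.
  have nP d (Z : measurableType d) (l : Z -> I) A :
      A `&` [set z | pickle (l z) = n] = set0.
    apply/seteqP; split => // z [_ /= lz]; move: En ni; rewrite -lz pickleK.
    by move=> [->]; rewrite eqxx.
  by rewrite !nP !integral_set0.
have sP d (Z : measurableType d) (l : Z -> I) A :
    A `&` [set z | pickle (l z) = n] = A `&` [set z | l z = i].
  congr (_ `&` _); rewrite -ni; apply/seteqP; split => z /=; last by move=> ->.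
  exact: (pcan_inj pickleK).
by rewrite !sP.
Qed.

Lemma integral_fibers (R : realType) d1 d2 (X : measurableType d1)
    (Y : measurableType d2) (I : countType)
    (mX : forall A : set X, measurable A) (mY : forall A : set Y, measurable A)
    (mu : {measure set X -> \bar R}) (nu : {measure set Y -> \bar R})
    (D : set X) (E : set Y) (h : X -> I) (k : Y -> I)
    (f : X -> \bar R) (g : Y -> \bar R) :
  (forall x, D x -> (0 <= f x)%E) -> (forall y, E y -> (0 <= g y)%E) ->
  (forall i, (\int[mu]_(x in D `&` [set x | h x = i]) f x =
              \int[nu]_(y in E `&` [set y | k y = i]) g y)%E) ->
  (\int[mu]_(x in D) f x = \int[nu]_(y in E) g y)%E.
Proof.
move=> f0 g0 fg; apply/eqP; rewrite eq_le; apply/andP; split.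
  by apply: (le_integral_fibers mX mY (h := h) (k := k) f0 g0) => i; rewrite fg.
by apply: (le_integral_fibers mY mX (h := k) (k := h) g0 f0) => i; rewrite fg.
Qed.

(** Change of variables for the law of Z on the event E, known only up to the
mass r of E; this avoids normalizing, so that r = 0 is harmless. *)
Lemma integral_scaled_law (R : realType) d (X : measurableType d)
    (mX : forall A : set X, measurable A) (mu : {measure set X -> \bar R})
    (E : set X) (Z : X -> rat) (q : probability rat R) (r : \bar R)
    (f : rat -> \bar R) :
  (0 <= r)%E -> (forall y, (0 <= f y)%E) ->
  (forall A, mu (E `&` [set x | A (Z x)]) = r * q A)%E ->
  (\int[mu]_(x in E) f (Z x) = r * \int[q]_y f y)%E.
Proof.
move=> r0 f0 lawZ.
have mrat (A : set rat) : measurable A by [].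
rewrite -ge0_integralZl//.
apply: (@integral_fibers R _ _ _ _ rat mX mrat mu q E setT Z id).
- by move=> x _.
- by move=> y _; rewrite mule_ge0.
move=> i; rewrite setTI.
have -> : (\int[mu]_(x in E `&` [set x | Z x = i]) f (Z x) =
    \int[mu]_(x in E `&` [set x | Z x = i]) cst (f i) x)%E.
  by apply: eq_integral => x /set_mem[_ /= ->].
have -> : (\int[q]_(y in [set y | y = i]) (r * f y) =
    \int[q]_(y in [set y | y = i]) cst (r * f i) y)%E.
  by apply: eq_integral => x /set_mem ->.
rewrite !integral_cst//.
by rewrite (lawZ [set y | y = i]) muleCA muleA.
Qed.

(** Jensen's bound: on E the mean of Z is m, and an affine function is
integrated by its value at the mean. *)
Lemma le_integral_line (R : realType) d (X : measurableType d)
    (mX : forall A : set X, measurable A) (P : probability X R)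
    (E : set X) (Z : X -> rat) (U m al be : rat) (f : X -> \bar R) :
  (forall x, E x -> ratI U (Z x)) ->
  (\int[P]_(x in E) (ratr (Z x) : R)%:E = (ratr m : R)%:E * P E)%E ->
  (forall x, E x -> (0 <= f x)%E) ->
  (forall x, E x -> (f x <= (ratr (al + be * Z x) : R)%:E)%E) ->
  (\int[P]_(x in E) f x <= (ratr (al + be * m) : R)%:E * P E)%E.
Proof.
move=> ZU Zm f0 fl.
have iZ : P.-integrable E (fun x => (ratr (Z x) : R)%:E).
  apply: (le_integrable (mX E) (g := EFin \o cst (ratr U))).
  - exact: (discrete_measurable_fun mX).
  - move=> x /ZU /andP[Z0 ZU']; rewrite /= lee_fin ger0_norm ?ler0q//.
    by rewrite ger0_norm ?ler_rat// ler0q (le_trans Z0).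
  - exact: (finite_measure_integrable_cst _ _ (mX E)).
apply: (@le_trans _ _
  (\int[P]_(x in E) ((ratr al)%:E + (ratr be)%:E * (ratr (Z x))%:E))%E).
  apply: ge0_le_integral => //.
  - by move=> x Ex; rewrite -EFinM -EFinD -rmorphM -rmorphD; exact: fl.
rewrite integralD//; last 2 first.
- exact: (finite_measure_integrable_cst _ _ (mX E)).
- exact: integrableZl.
rewrite integralZl// Zm integral_cst//.
rewrite muleA -EFinM -muleDl//; last exact: fin_num_measure.
by rewrite -EFinD -rmorphM -rmorphD.
Qed.

(** * Two-point laws and affine majorants *)

Lemma fM_le_line (R : realType) (U m al be : rat) (f : rat -> \bar R)
    (Q : probability rat R) :
  (forall q, ratI U q -> (0 <= f q)%E) ->
  (forall q, ratI U q -> (f q <= (ratr (al + be * q) : R)%:E)%E) ->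
  fM U m Q ->
  (\int[Q]_(q in ratI U) f q <= (ratr (al + be * m) : R)%:E)%E.
Proof.
move=> f0 fl [QU Qm].
have mrat (A : set rat) : measurable A by [].
have := @le_integral_line R _ rat mrat Q (ratI U) id U m al be f.
by rewrite QU !mule1; apply.
Qed.

Lemma g_of_le_line (R : realType) (U m al be : rat)
    (f : rat -> rat -> \bar R) (x : rat) :
  (forall q, ratI U q -> (0 <= f x q)%E) ->
  (forall q, ratI U q -> (f x q <= (ratr (al + be * q) : R)%:E)%E) ->
  (g_of U f x m <= (ratr (al + be * m) : R)%:E)%E.
Proof.
by move=> f0 fl; apply: ge_ereal_sup => _ [Q QM <-]; exact: fM_le_line QM.
Qed.

Lemma integral_two_point (R : realType) (a a' p : rat) (f : rat -> \bar R) :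
  0 <= p <= 1 -> (forall q, (0 <= f q)%E) ->
  (\int[two_point R a a' p]_q f q =
     (ratr p : R)%:E * f a' + (ratr (1 - p) : R)%:E * f a)%E.
Proof.
move=> /andP[p0 p1] f0.
rewrite /two_point ge0_integral_distribution// integral_bernoulli_prob//=.
  by rewrite rmorphB rmorph1.
by rewrite ler0q p0 -(rmorph1 ratr) ler_rat.
Qed.

Lemma two_point_ratI (R : realType) (U a a' p : rat) :
  ratI U a -> ratI U a' -> two_point R a a' p (ratI U) = 1%E.
Proof.
move=> aU a'U; rewrite /two_point /distribution /pushforward /=.
suff -> : pick_atom a a' @^-1` ratI U = setT by exact: probability_setT.
by apply/seteqP; split => // -[].
Qed.

Lemma integral_ratI (R : realType) (U : rat) (Q : probability rat R)
    (f : rat -> \bar R) : Q (ratI U) = 1%E ->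
  (\int[Q]_(q in ratI U) f q = \int[Q]_q f q)%E.
Proof.
move=> QU; rewrite -[setT](setUv (ratI U)).
have mrat (A : set rat) : measurable A by [].
have QC : Q (~` ratI U) = 0%E by rewrite probability_setC// QU subee.
rewrite integral_setU//; last by rewrite disj_set2E setICr.
rewrite (@null_set_integral _ _ _ _ (~` ratI U)) ?adde0//.
Qed.

Lemma integral_two_point_ratI (R : realType) (U a a' p : rat)
    (f : rat -> \bar R) : ratI U a -> ratI U a' -> 0 <= p <= 1 ->
  (forall q, ratI U q -> (0 <= f q)%E) ->
  (\int[two_point R a a' p]_(q in ratI U) f q =
     (ratr p : R)%:E * f a' + (ratr (1 - p) : R)%:E * f a)%E.
Proof.
move=> aU a'U p01 f0.
pose g q := if 0 <= q <= U then f q else 0%E.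
have g0 q : (0 <= g q)%E by rewrite /g; case: ifP => // /f0.
rewrite (eq_integral g); last by move=> q /set_mem qU; rewrite /g ifT.
rewrite integral_ratI ?integral_two_point//; last exact: two_point_ratI.
by rewrite /g !ifT.
Qed.

Lemma two_point_fM (R : realType) (U a a' p m : rat) :
  ratI U a -> ratI U a' -> 0 <= p <= 1 -> p * a' + (1 - p) * a = m ->
  fM U m (two_point R a a' p).
Proof.
move=> aU a'U p01 <-; split; first exact: two_point_ratI.
pose f (q : rat) : \bar R := (`|ratr q|)%:E.
transitivity (\int[two_point R a a' p]_(q in ratI U) f q)%E.
  apply: eq_integral => q /set_mem /andP[q0 _].
  by rewrite /f ger0_norm// ler0q.
rewrite integral_two_point_ratI//; last by move=> q _; rewrite lee_fin.
have /andP[a0 _] := aU; have /andP[a'0 _] := a'U.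
by rewrite /f !ger0_norm ?ler0q// -!EFinM -EFinD -!rmorphM -rmorphD.
Qed.

Lemma two_point_ge (R : realType) (U a a' p c c' : rat) (f : rat -> \bar R) :
  ratI U a -> ratI U a' -> 0 <= p <= 1 -> (forall q, ratI U q -> (0 <= f q)%E)
    ->
  ((ratr c : R)%:E <= f a)%E -> ((ratr c' : R)%:E <= f a')%E ->
  ((ratr (p * c' + (1 - p) * c) : R)%:E <=
     \int[two_point R a a' p]_(q in ratI U) f q)%E.
Proof.
move=> aU a'U p01 f0 ca ca'; rewrite integral_two_point_ratI//.
have /andP[p0 p1] := p01.
rewrite rmorphD !rmorphM EFinD !EFinM leeD// lee_wpmul2l// lee_fin ler0q//.
by rewrite subr_ge0.
Qed.

(** * Cost bounds by affine functions of the demand *)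

(** The chord of the cost-to-go through A_(i-1) and A_i, as a function of the
mean m at order level x; its x-slope is -b. *)
Definition Hfun (U b : rat) (n i : nat) (x m : rat) : rat :=
  ((n%:R - i%:R) * b - i%:R) * m + i%:R * Acoef U b n i%:Z - b * x.

(** The cost of the n periods ahead at stock y and last demand m; [V_of] alone
would not give 0 for n = 0 when no law or no order level is available. *)
Definition cost_to_go (R : realType) (U b : rat) (n : nat) (y m : rat) : \bar R
  :=
  if n is 0%N then 0%E else V_of U (fhat R U b n) y m.

Section Bounds.
Variables (R : realType) (U b : rat).
Hypotheses (U_gt0 : 0 < U) (b_gt0 : 0 < b).
Implicit Types (n i k : nat) (x y z d m : rat).
Local Notation A n k := (Acoef U b n (Posz k)).
Local Notation B n k := (Bcoef U b n (Posz k)).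
Local Notation fhat := (fhat R U b).
Local Notation ghat := (ghat R U b).
Local Notation V n := (V_of U (fhat n)).
Local Notation "q %:RE" := (ratr q : R)%:E (at level 2, format "q %:RE").

Lemma fhatS n x d : fhat n.+1 x d = ((C b x d)%:RE + cost_to_go R U b n (x - d)
  d)%E.
Proof. by []. Qed.

Lemma C_ge0 x d : 0 <= C b x d.
Proof.
by rewrite /C addr_ge0 ?mulr_ge0 ?le_max ?lexx ?orbT// ltW.
Qed.

Lemma C_over x d : d <= x -> C b x d = x - d.
Proof.
move=> dx; rewrite /C max_r ?subr_le0// mulr0 add0r max_l ?subr_ge0//.
Qed.

Lemma C_under x d : x <= d -> C b x d = b * (d - x).
Proof.
move=> dx; rewrite /C [X in _ + X]max_r ?subr_le0// addr0 max_l ?subr_ge0//.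
Qed.

Lemma C_ge_under x d : b * (d - x) <= C b x d.
Proof.
have b0 := b_gt0; case: (lerP x d) => xd; first by rewrite C_under.
rewrite C_over ?ltW//.
have : b * (d - x) <= 0 by apply: mulr_ge0_le0; lra.
lra.
Qed.

Lemma ratI_top : ratI U U.
Proof. by apply/andP; split=> //; exact: ltW. Qed.

Lemma ratI0 : ratI U 0.
Proof. by apply/andP; split=> //; exact: ltW. Qed.

Lemma ratI_A n k : (k <= n)%N -> ratI U (A n.+1 k).
Proof.
move=> kn; apply/andP; split; last exact: Acoef_leU.
exact/ltW/Acoef_gt0/leqW.
Qed.

Lemma ratI_B n k : (k <= n.+1)%N -> ratI U (B n.+1 k).
Proof. by move=> kn; apply/andP; split;
  [exact: Bcoef_ge0|exact: Bcoef_leU]. Qed.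

Lemma div_unit (u v : rat) : 0 <= u -> u <= v -> 0 < v -> 0 <= u / v <= 1.
Proof. by move=> u0 uv v0;
  rewrite divr_ge0 ?(ltW v0)//= ler_pdivrMr// mul1r. Qed.

(** Without a competing law the supremum g would be -oo, so this is what makes
all costs nonnegative. *)
Lemma fM_nonempty m : ratI U m -> fM U m (two_point R 0 U (m / U)).
Proof.
move=> /andP[m0 mU]; apply: two_point_fM.
- exact: ratI0.
- exact: ratI_top.
- exact: div_unit.
- by rewrite mulr0 addr0 divfK// gt_eqF.
Qed.

Lemma g_of_ge0 (f : rat -> rat -> \bar R) x m : ratI U m ->
  (forall q, ratI U q -> (0 <= f x q)%E) -> (0 <= g_of U f x m)%E.
Proof.
move=> /fM_nonempty mM f0.
pose Q : probability rat R := two_point R 0 U (m / U).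
apply: (@le_trans _ _ (\int[Q]_(q in ratI U) f x q)%E).
  exact: integral_ge0.
by apply: ereal_sup_ubound; exists Q.
Qed.

Lemma fhat_ge0 n x d : ratI U d -> (0 <= fhat n x d)%E.
Proof.
elim: n x d => [//|n IH] x d dU; rewrite fhatS adde_ge0//.
  by rewrite lee_fin ler0q C_ge0.
case: n IH => // n IH; apply: le_ereal_inf_tmp => _ [z _ <-].
by apply: g_of_ge0 => // q; exact: IH.
Qed.

Lemma ghat_ge_integral n x m (Q : probability rat R) : fM U m Q ->
  (\int[Q]_(q in ratI U) fhat n x q <= ghat n x m)%E.
Proof. by move=> QM; apply: ereal_sup_ubound; exists Q. Qed.

Lemma V_le_ghat n y z m : y <= z -> ratI U z -> (V n y m <= ghat n z m)%E.
Proof. by move=> yz zU; apply: ereal_inf_lbound; exists z. Qed.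

Lemma ghat_le_line n x m al be :
  (forall q, ratI U q -> (fhat n x q <= (al + be * q)%:RE)%E) ->
  (ghat n x m <= (al + be * m)%:RE)%E.
Proof. by move=> fl; apply: g_of_le_line => // q; exact: fhat_ge0. Qed.

Lemma Gfun_affine n k x m : Gfun U b n k%:Z x m =
  n%:R * x + ((n%:R - k%:R) * b - (b + n%:R) / A n k * x) * m.
Proof. by rewrite /Gfun -pmulrn; ring. Qed.

Lemma Hfun_affine n i x m : Hfun U b n i x m =
  (i%:R * A n i - b * x) + ((n%:R - i%:R) * b - i%:R) * m.
Proof. by rewrite /Hfun; ring. Qed.

Definition cost_le_G n := forall k x d, (k <= n)%N -> ratI U x -> ratI U d ->
  B n.+1 k <= x <= B n.+1 k.+1 ->
  (fhat n.+1 x d <= (Gfun U b n.+1 k%:Z x d)%:RE)%E.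

Definition cost_le_H n := forall i x d, (i <= n)%N -> ratI U x -> ratI U d ->
  x <= B n.+1 i -> (fhat n.+1 x d <= (Hfun U b n.+1 i x d)%:RE)%E.

Lemma ghat_le_G n : cost_le_G n -> forall k x m, (k <= n)%N -> ratI U x ->
  B n.+1 k <= x <= B n.+1 k.+1 ->
  (ghat n.+1 x m <= (Gfun U b n.+1 k%:Z x m)%:RE)%E.
Proof.
move=> upG k x m kn xU xB.
rewrite Gfun_affine; apply: ghat_le_line => q qU.
by rewrite -Gfun_affine; exact: upG.
Qed.

Lemma ghat_le_H n : cost_le_H n -> forall i x m, (i <= n)%N -> ratI U x ->
  x <= B n.+1 i -> (ghat n.+1 x m <= (Hfun U b n.+1 i x m)%:RE)%E.
Proof.
move=> upH i x m iln xU xB.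
rewrite Hfun_affine; apply: ghat_le_line => q qU.
by rewrite -Hfun_affine; exact: upH.
Qed.

Lemma Bcoef_prev n k : (k <= n.+1)%N -> B n.+1 k = k%:R / n.+1%:R * A n.+2 k.
Proof.
move=> kn; rewrite Acoef_step// Bcoef_nat; field.
by rewrite !nat1r pnatr_eq0/= gt_eqF// ltr_wpDr ?ler0n.
Qed.

(** The order level z ranges over the piece k. Everything is expressed by the
break points of the horizon with one more period, the one of the induction
step. *)
Lemma V_le_piece n : cost_le_G n -> forall k y z m, (k <= n)%N ->
  y <= z -> ratI U z ->
  k%:R * A n.+2 k <= n.+1%:R * z <= (b + k.+1%:R) * A n.+2 k ->
  (V n.+1 y m <= ((n.+1%:R - n.+1%:R / A n.+2 k * m) * z
                    + (n.+1%:R - k%:R) * b * m)%:RE)%E.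
Proof.
move=> upG k y z m kn yz zU /andP[z1 z2].
have n0 : 0 < n.+1%:R :> rat by rewrite ltr0n.
have bn0 : 0 < b + n.+1%:R by rewrite addr_gt0.
have A0 : 0 < A n.+1 k by apply: Acoef_gt0 => //; exact: leqW.
apply: le_trans (V_le_ghat _ _ yz zU) _.
have -> : (n.+1%:R - n.+1%:R / A n.+2 k * m) * z + (n.+1%:R - k%:R) * b * m =
    Gfun U b n.+1 k%:Z z m.
  rewrite /Gfun -pmulrn Acoef_step ?leqW//; field.
  by rewrite !nat1r pnatr_eq0/= !gt_eqF.
apply: ghat_le_G => //.
rewrite Bcoef_succ// Bcoef_prev ?leqW//.
rewrite -(ler_pM2l n0) mulrA (mulrCA n.+1%:R) divff ?gt_eqF// mulr1 z1/=.
rewrite -(ler_pM2l n0); apply: le_trans z2 _.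
rewrite Acoef_step ?leqW// le_eqVlt; apply/orP; left; apply/eqP; field.
by rewrite !nat1r gt_eqF.
Qed.

(** Ordering up to B_i, an end point of a piece: the bound is then affine in m
and does not depend on y. *)
Lemma V_le_line n : cost_le_G n -> forall i y m, (i <= n.+1)%N ->
  n.+1%:R * y <= i%:R * A n.+2 i ->
  (V n.+1 y m <= (((n.+1%:R - i%:R) * b - i%:R) * m + i%:R * A n.+2 i)%:RE)%E.
Proof.
move=> upG i y m; rewrite leq_eqVlt => /predU1P[->|].
  have bn0 : 0 < b + n.+1%:R by rewrite addr_gt0// ltr0n.
  have AE : (b + n.+1%:R) * A n.+2 n = n.+1%:R * U.
    by rewrite -Acoef_rec// Acoef_last.
  rewrite Acoef_last (ler_pM2l (_ : 0 < n.+1%:R)) ?ltr0n// => yU.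
  (* B_(n+1) = U closes the last piece, of index n *)
  apply: le_trans (@V_le_piece n upG n y U m _ yU _ _) _ => //.
  - exact: ratI_top.
  - rewrite AE lexx andbT; apply: ler_pM; rewrite ?ler0n ?ler_nat//.
      exact/ltW/Acoef_gt0/leqW.
    exact: Acoef_leU.
  - rewrite lee_fin ler_rat le_eqVlt; apply/orP; left; apply/eqP.
    rewrite (_ : n.+1%:R / A n.+2 n * m = (b + n.+1%:R) * m / U).
      by rewrite -natr1; field; rewrite gt_eqF.
    have -> : A n.+2 n = n.+1%:R * U / (b + n.+1%:R).
      by rewrite -AE; field; rewrite nat1r gt_eqF.
    by field; rewrite !nat1r !gt_eqF.
rewrite ltnS => iln yB.
have n0 : 0 < n.+1%:R :> rat by rewrite ltr0n.
have zE : n.+1%:R * B n.+1 i = i%:R * A n.+2 i.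
  by rewrite Bcoef_prev ?leqW// mulrA (mulrCA n.+1%:R) divff ?gt_eqF// mulr1.
have A0 : 0 < A n.+2 i by apply: Acoef_gt0 => //; rewrite !leqW.
apply: le_trans (@V_le_piece n upG i y (B n.+1 i) m iln _ _ _) _ => //.
- by rewrite -(ler_pM2l n0) zE.
- exact/ratI_B/leqW.
- rewrite zE lexx/= ler_pM2r// -natr1; have := b_gt0; lra.
- rewrite lee_fin ler_rat le_eqVlt; apply/orP; left; apply/eqP.
  rewrite mulrBl zE.
  have -> : n.+1%:R / A n.+2 i * m * B n.+1 i = i%:R * m.
    by rewrite -mulrA (mulrC m) mulrA (mulrAC n.+1%:R) zE mulfK ?gt_eqF.
  ring.
Qed.

End Bounds.

(** * Induction step for the bound by the chord from 0 *)

Section Step.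
Variables (R : realType) (U b : rat).
Hypotheses (U_gt0 : 0 < U) (b_gt0 : 0 < b).
Implicit Types (n i k : nat) (x y z d m : rat).
Local Notation A n k := (Acoef U b n (Posz k)).
Local Notation B n k := (Bcoef U b n (Posz k)).
Local Notation fhat := (fhat R U b).
Local Notation ghat := (ghat R U b).
Local Notation V n := (V_of U (fhat n)).
Local Notation "q %:RE" := (ratr q : R)%:E (at level 2, format "q %:RE").

Local Notation cost_le_G := (cost_le_G R U b).
Local Notation cost_le_H := (cost_le_H R U b).

Lemma fhatS_le n x d v c : (V n.+1 (x - d)%R d <= v%:RE)%E -> C b x d + v <= c
  ->
  (fhat n.+2 x d <= c%:RE)%E.
Proof.
move=> Vv Cv; rewrite fhatS; apply: le_trans (leeD2l _ Vv) _.
by rewrite -EFinD -rmorphD lee_fin ler_rat.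
Qed.

Lemma Gfun_scaled n k (u v : rat) : (k <= n.+1)%N ->
  Gfun U b n.+2 k%:Z (A n.+2 k * u) (A n.+2 k * v) =
  A n.+2 k * scaledG b n.+1%:R k%:R u v.
Proof.
move=> kn; have A0 : 0 < A n.+2 k by apply: Acoef_gt0 => //; exact: leqW.
rewrite /Gfun /scaledG -pmulrn -[n.+2%:R]natr1; field.
by rewrite gt_eqF.
Qed.

(** The demand is below the order level, so leftover stock u - v may exceed the
level one would order up to; the witness w is the cost of the remaining periods
in units of A_k. If x is above B_k of the shorter horizon, the leftover is
either still above it (keep it: piece k) or below it (order up: line k). If x
is below it, the same alternative arises one index lower unless the demand is
at least A_(k-1). *)
Lemma scale_over n k (u v : rat) : (k <= n.+1)%N -> cost_le_G n ->
  let a := A n.+2 k in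
  k%:R <= (b + n.+1%:R + 1) * u -> (b + n.+1%:R + 1) * u <= b + k%:R + 1 ->
  0 <= v -> v <= u -> ratI U (a * u) ->
  exists2 w, (V n.+1 (a * u - a * v)%R (a * v)%R <= (a * w)%:RE)%E &
    (u - v) + w <= scaledG b n.+1%:R k%:R u v.
Proof.
move=> kn upG a u_lo u_hi v0 vu xU.
have kn' := leqW kn.
have a0 : 0 < a by apply: Acoef_gt0.
have s0 : 0 < n.+1%:R :> rat by rewrite ltr0n.
have k0 : 0 <= k%:R :> rat by rewrite ler0n.
have ks : k%:R <= n.+1%:R :> rat by rewrite ler_nat.
have b0 := b_gt0.
have u0 : 0 <= u by lra.
have uv0 : 0 <= u - v by lra.
have zU : ratI U (a * u - a * v).
  have /andP[_ xtop] := xU; rewrite -mulrBr; apply/andP; split.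
    by apply: mulr_ge0 => //; exact: ltW.
  by apply: le_trans xtop; rewrite ler_pM2l//; lra.
have zE : n.+1%:R * (a * u - a * v) = a * (n.+1%:R * (u - v)).
  by rewrite -mulrBr mulrCA.
have line_k : n.+1%:R * (u - v) <= k%:R ->
    (V n.+1 (a * u - a * v)%R (a * v)%R <=
      (a * (((n.+1%:R - k%:R) * b - k%:R) * v + k%:R))%:RE)%E.
  move=> uvk; rewrite mulrDr mulrCA (mulrC a k%:R).
  by apply: V_le_line => //; rewrite zE mulrC ler_pM2r.
have T0 : 0 < b + n.+1%:R + 1 by lra.
have u1 : u <= 1 by rewrite -(ler_pM2l T0) mulr1; lra.
have suv : n.+1%:R * (u - v) <= n.+1%:R * u by rewrite ler_pM2l//; lra.
case: (lerP k%:R (n.+1%:R * u)) => ksu.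
  case: (lerP (n.+1%:R * (u - v)) k%:R) => uvk.
    by exists (((n.+1%:R - k%:R) * b - k%:R) * v + k%:R);
      [exact: line_k | exact: scaled_line_below].
  have kn1 : (k <= n)%N.
    rewrite -ltnS ltn_neqAle kn andbT; apply: contraTneq uvk => ->.
    rewrite -leNgt; apply: le_trans suv _.
    by rewrite ler_piMr// ler0n.
  exists ((n.+1%:R - n.+1%:R * v) * (u - v) + (n.+1%:R - k%:R) * b * v).
    have -> : a * ((n.+1%:R - n.+1%:R * v) * (u - v) + (n.+1%:R - k%:R) * b * v)
      = (n.+1%:R - n.+1%:R / a * (a * v)) * (a * u - a * v)
        + (n.+1%:R - k%:R) * b * (a * v).
      by field; rewrite gt_eqF.
    apply: V_le_piece => //.
    rewrite -/a zE (mulrC k%:R) (mulrC (b + _)) !ler_pM2l// (ltW uvk)/=.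
    rewrite -[k.+1%:R]natr1; have : 0 <= (b + 1) * u by apply: mulr_ge0; lra.
    lra.
  by apply: scaled_piece => //; exact: ltW.
have [j kE] : exists j, k = j.+1.
  exists k.-1; rewrite prednK// lt0n; apply: contraTneq ksu => ->.
  by rewrite -leNgt; apply: mulr_ge0 => //; exact: ltW.
have kj : k%:R = j%:R + 1 :> rat by rewrite kE natr1.
have bk : 0 < b + k%:R by lra.
have k1 : 0 < k%:R :> rat by rewrite kE ltr0n.
have [c c0 ck] : exists2 c : rat, 0 < c & (b + k%:R) * c = k%:R.
  by exists (k%:R / (b + k%:R));
    [exact: divr_gt0 | rewrite mulrC divfK// gt_eqF].
have AjE : A n.+2 j = a * c.
  rewrite -(Acoef_predE U b _ j) -kE.
  by rewrite Acoef_pred// -[X in X / _]ck (mulrC (b + _)) mulfK ?gt_eqF// mulrC.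
have jn : (j <= n)%N by rewrite -ltnS -kE.
case: (lerP k%:R ((b + k%:R) * v)) => kv.
  exists (((n.+1%:R - k%:R) * b - k%:R) * v + k%:R); first by apply: line_k;
    lra.
  by apply: scaled_line_far => //; exact: ltW.
have vc : v <= c by rewrite -(ler_pM2l bk) ck ltW.
case: (lerP (n.+1%:R * (u - v)) ((k%:R - 1) * c)) => uvj.
  exists (((n.+1%:R - (k%:R - 1)) * b - (k%:R - 1)) * v + (k%:R - 1) * c).
    have -> : a * (((n.+1%:R - (k%:R - 1)) * b - (k%:R - 1)) * v + (k%:R - 1) *
      c)
      = ((n.+1%:R - j%:R) * b - j%:R) * (a * v) + j%:R * A n.+2 j.
      by rewrite AjE kj; ring.
    apply: V_le_line => //; first exact: leqW.
    by rewrite zE AjE [leRHS]mulrCA ler_pM2l//; move: uvj; rewrite kj addrK.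
  by apply: scaled_prev_line => //; exact: ltW.
exists ((n.+1%:R - n.+1%:R / c * v) * (u - v) + (n.+1%:R - (k%:R - 1)) * b * v).
  have -> : a * ((n.+1%:R - n.+1%:R / c * v) * (u - v)
      + (n.+1%:R - (k%:R - 1)) * b * v)
    = (n.+1%:R - n.+1%:R / A n.+2 j * (a * v)) * (a * u - a * v)
      + (n.+1%:R - j%:R) * b * (a * v).
    by rewrite AjE kj; field; rewrite !gt_eqF.
  apply: V_le_piece => //.
  rewrite zE AjE !(mulrCA _ a) !ler_pM2l// -kE ck; apply/andP; split.
    by move: uvj; rewrite kj addrK => /ltW.
  by lra.
by apply: scaled_prev_piece => //; exact: ltW.
Qed.

(** The demand is at or above the order level: no stock is left, every level
can be ordered, and only the position of the demand relative to A_k matters. *)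
Lemma scale_under n k (u v : rat) : (k <= n.+1)%N -> cost_le_G n ->
  let a := A n.+2 k in
  k%:R <= (b + n.+1%:R + 1) * u -> (b + n.+1%:R + 1) * u <= b + k%:R + 1 ->
  u <= v -> a * v <= U ->
  exists2 w, (V n.+1 (a * u - a * v)%R (a * v)%R <= (a * w)%:RE)%E &
    b * (v - u) + w <= scaledG b n.+1%:R k%:R u v.
Proof.
move=> kn upG a u_lo u_hi uv dU.
have kn' := leqW kn.
have a0 : 0 < a by apply: Acoef_gt0.
have s0 : 0 < n.+1%:R :> rat by rewrite ltr0n.
have below i : (i <= n.+2)%N ->
    n.+1%:R * (a * u - a * v) <= i%:R * A n.+2 i.
  move=> iln; apply: (@le_trans _ _ 0).
    apply: mulr_ge0_le0; first exact: ltW.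
    by rewrite -mulrBr; apply: mulr_ge0_le0; [exact: ltW | lra].
  by apply: mulr_ge0 => //; apply/ltW/Acoef_gt0.
case: (lerP v 1) => v1.
  exists (((n.+1%:R - k%:R) * b - k%:R) * v + k%:R).
    rewrite mulrDr mulrCA (mulrC a k%:R).
    by apply: V_le_line => //; exact: below.
  exact: scaled_line_above.
have kn1 : (k < n.+1)%N.
  rewrite ltn_neqAle kn andbT; apply: contraTneq v1 => kE.
  by move: dU a0; rewrite /a kE Acoef_last -leNgt -{2}[U]mulr1 => + a0;
    rewrite ler_pM2l.
exists (((n.+1%:R - k.+1%:R) * b - k.+1%:R) * v + (b + k%:R + 1)).
  have -> : a * (((n.+1%:R - k.+1%:R) * b - k.+1%:R) * v + (b + k%:R + 1)) =
     ((n.+1%:R - k.+1%:R) * b - k.+1%:R) * (a * v) + k.+1%:R * A n.+2 k.+1.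
    by rewrite Acoef_rec// -[k.+1%:R]natr1 /a; ring.
  by apply: V_le_line => //; apply: below; exact: leqW.
have := @scaled_next_line_above b n.+1%:R k%:R u v u_hi (ltW v1).
rewrite -[k.+1%:R]natr1; lra.
Qed.

Lemma cost_le_G_step n : cost_le_G n -> cost_le_G n.+1.
Proof.
move=> upG k x d kn xU dU /andP[].
have a0 : 0 < A n.+2 k by apply: Acoef_gt0 => //; exact: leqW.
have T0 : 0 < b + n.+1%:R + 1 by rewrite addr_gt0// addr_gt0.
rewrite Bcoef_succ// Bcoef_nat -[n.+2%:R]natr1 addrA.
have [u xE] : exists u, x = A n.+2 k * u.
  by exists (x / A n.+2 k); rewrite mulrC divfK// gt_eqF.
have [v dE] : exists v, d = A n.+2 k * v.
  by exists (d / A n.+2 k); rewrite mulrC divfK// gt_eqF.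
subst x d; rewrite !(mulrC _ (A _ _)) !(ler_pM2l a0).
rewrite ler_pdivrMr// ler_pdivlMr// (mulrC u) -[k.+1%:R]natr1 addrA => u_lo
  u_hi.
rewrite Gfun_scaled//.
have /andP[] := dU; rewrite pmulr_rge0// => v0 dtop.
case: (lerP v u) => vu.
  have [w Vw Cw] := scale_over kn upG u_lo u_hi v0 vu xU.
  apply: fhatS_le Vw _.
  by rewrite C_over ?ler_pM2l// -mulrBr -mulrDr ler_pM2l.
have [w Vw Cw] := scale_under kn upG u_lo u_hi (ltW vu) dtop.
apply: fhatS_le Vw _.
by rewrite C_under ?ler_pM2l ?(ltW vu)// -mulrBr mulrCA -mulrDr ler_pM2l.
Qed.

End Step.

(** * The two chord bounds for every horizon *)

Section ChordBounds.
Variables (R : realType) (U b : rat).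
Hypotheses (U_gt0 : 0 < U) (b_gt0 : 0 < b).
Implicit Types (n i k : nat) (x y z d m : rat).
Local Notation A n k := (Acoef U b n (Posz k)).
Local Notation B n k := (Bcoef U b n (Posz k)).
Local Notation fhat := (fhat R U b).
Local Notation ghat := (ghat R U b).
Local Notation V n := (V_of U (fhat n)).
Local Notation "q %:RE" := (ratr q : R)%:E (at level 2, format "q %:RE").

Local Notation cost_le_G := (cost_le_G R U b).
Local Notation cost_le_H := (cost_le_H R U b).

(** Consecutive chords cross at A_j, the later one being steeper downwards. *)
Lemma Hfun_step n j x d : (j <= n)%N -> d <= A n.+1 j ->
  Hfun U b n.+1 j x d <= Hfun U b n.+1 j.+1 x d.
Proof.
move=> jn dA; have b0 := b_gt0; have bj : 0 < b + j.+1%:R by rewrite addr_gt0.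
rewrite /Hfun Acoef_rec// -[j.+1%:R]natr1.
have : 0 <= (b + 1) * (A n.+1 j - d) by apply: mulr_ge0; lra.
lra.
Qed.

Lemma Hfun_le n i j x d : (i <= j <= n)%N -> d <= A n.+1 i ->
  Hfun U b n.+1 i x d <= Hfun U b n.+1 j x d.
Proof.
move=> /andP[+ +] dA; elim: j => [|j IH]; first by rewrite leqn0 => /eqP->.
rewrite leq_eqVlt => /predU1P[->//|ij jn].
apply: le_trans (IH ij (ltnW jn)) _; apply: Hfun_step; first exact: ltnW.
by apply: le_trans dA _; apply: Acoef_le => //; rewrite -ltnS ij ltnW.
Qed.

Lemma Gfun_le_H n k x d : (k <= n)%N -> x <= B n.+1 k.+1 -> d <= A n.+1 k ->
  Gfun U b n.+1 k%:Z x d <= Hfun U b n.+1 k.+1 x d.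
Proof.
move=> kn + dA; have a0 : 0 < A n.+1 k by apply: Acoef_gt0 => //; exact: leqW.
have bk : 0 < b + k.+1%:R by rewrite addr_gt0.
have bn : 0 < b + n.+1%:R by rewrite addr_gt0.
have [u xE] : exists u, x = A n.+1 k * u.
  by exists (x / A n.+1 k); rewrite mulrC divfK// gt_eqF.
rewrite Bcoef_succ// xE (mulrC _ (A _ _)) ler_pM2l// ler_pdivlMr// => uB.
rewrite /Hfun Acoef_rec// /Gfun -pmulrn -subr_ge0.
rewrite [X in 0 <= X](_ : _ =
  (A n.+1 k - d) * (b + k.+1%:R - u * (b + n.+1%:R))).
  by apply: mulr_ge0; lra.
by rewrite -[k.+1%:R]natr1; field; rewrite gt_eqF.
Qed.

Lemma Gfun_at_B n k d : (k <= n)%N ->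
  Gfun U b n.+1 k%:Z (B n.+1 k) d = Hfun U b n.+1 k (B n.+1 k) d.
Proof.
move=> kn; have a0 : 0 < A n.+1 k by apply: Acoef_gt0 => //; exact: leqW.
have bn : 0 < b + n.+1%:R by rewrite addr_gt0.
rewrite /Hfun /Gfun -pmulrn Bcoef_nat; field.
by rewrite nat1r !gt_eqF.
Qed.

Lemma Bcoef_succ_le_A n k : (k <= n)%N -> B n.+1 k.+1 <= A n.+1 k.
Proof.
move=> kn; have a0 : 0 < A n.+1 k by apply: Acoef_gt0 => //; exact: leqW.
have bn : 0 < b + n.+1%:R by rewrite addr_gt0.
by rewrite Bcoef_succ// ler_piMl ?(ltW a0)// ler_pdivrMr// mul1r lerD2l ler_nat.
Qed.

Lemma Bcoef_ltU n i : (i <= n)%N -> B n.+1 i < U.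
Proof.
move=> iln; have inn : (i <= n <= n.+1)%N by rewrite iln leqnSn.
apply: le_lt_trans (Bcoef_le U_gt0 b_gt0 inn) _.
have bn : 0 < b + n.+1%:R by rewrite addr_gt0.
rewrite Bcoef_nat Acoef_last gtr_pMl// ltr_pdivrMr// mul1r -[n.+1%:R]natr1.
have := b_gt0; lra.
Qed.

(** For a demand below the order level the bound by H_i follows from that by
G_k: the demand is then also below A_k, where the later chords lie above
G_k. *)
Lemma cost_le_H_over n : cost_le_G n -> forall i x d, (i <= n)%N ->
  ratI U x -> ratI U d -> d < x -> x <= B n.+1 i ->
  (fhat n.+1 x d <= (Hfun U b n.+1 i x d)%:RE)%E.
Proof.
move=> upG i x d iln xU dU dx xB.
have /andP[x0 _] := xU.
move: xB; rewrite le_eqVlt => /predU1P[xB|xB].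
  rewrite xB -Gfun_at_B//; apply: upG => //; first by rewrite -xB.
  by rewrite lexx Bcoef_le// leqnSn ltnS.
have [k kn /andP[k1 k2]] := Bcoef_bracket b_gt0 n x0
  (lt_trans xB (Bcoef_ltU iln)).
have ki : (k < i)%N.
  rewrite ltnNge; apply/negP => ik.
  have ikn : (i <= k <= n.+1)%N by rewrite ik leqW.
  by have := Bcoef_le U_gt0 b_gt0 ikn; rewrite leNgt (le_lt_trans k1 xB).
have dA : d <= A n.+1 k.
  by apply: le_trans (ltW dx) _; apply: le_trans (ltW k2) _;
    exact: Bcoef_succ_le_A.
apply: (@le_trans _ _ (Gfun U b n.+1 k%:Z x d)%:RE).
  by apply: upG => //; rewrite k1 ltW.
rewrite lee_fin ler_rat; apply: le_trans (Gfun_le_H kn (ltW k2) dA) _.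
apply: Hfun_le; first by rewrite ki.
by apply: le_trans dA _; apply: Acoef_le => //; rewrite leqnSn (leq_trans ki).
Qed.

Lemma cost_le_G_base : cost_le_G 0.
Proof.
move=> k x d; rewrite leqn0 => /eqP-> xU dU _.
have /andP[x0 xtop] := xU; have /andP[d0 dtop] := dU.
rewrite fhatS adde0 lee_fin ler_rat.
have [u xE] : exists u, x = U * u.
  by exists (x / U); rewrite mulrC divfK// gt_eqF.
have [v dE] : exists v, d = U * v.
  by exists (d / U); rewrite mulrC divfK// gt_eqF.
have b0 := b_gt0.
move: x0 xtop d0 dtop; rewrite xE dE !pmulr_rge0// => u0 + v0.
rewrite -{2 4}[U]mulr1 !ler_pM2l// => u1 v1.
have -> : Gfun U b 1 0%:Z (U * u) (U * v) = U * scaledG b 0 0 u v.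
  by rewrite /Gfun /scaledG -pmulrn (Acoef_last U b 0); field; rewrite gt_eqF.
case: (lerP v u) => vu.
  rewrite C_over ?ler_pM2l// -mulrBr ler_pM2l//.
  have := @scaled_piece b 0 0 u v b0 (lexx _) u1 v0 vu; lra.
rewrite C_under ?ler_pM2l ?(ltW vu)// -mulrBr mulrCA ler_pM2l//.
have c0 : 0 <= (b + 0 + 1) * u by apply: mulr_ge0; lra.
have := @scaled_line_above b 0 0 u v c0 v1; lra.
Qed.

Lemma cost_le_G_all n : cost_le_G n.
Proof. by elim: n => [|n]; [exact: cost_le_G_base | exact: cost_le_G_step]. Qed.

Lemma cost_le_H_all n : cost_le_H n.
Proof.
move=> i x d iln xU dU xB.
have /andP[x0 _] := xU; have /andP[d0 dtop] := dU.
case: (ltP d x) => dx;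
  first exact: cost_le_H_over (@cost_le_G_all n) _ _ _ _ _ _ _ _.
case: n iln xB => [|n] iln xB.
  move: iln; rewrite leqn0 fhatS adde0 C_under// lee_fin ler_rat => /eqP->.
  by rewrite /Hfun; lra.
have VL : (V n.+1 (x - d)%R d <= (((n.+1%:R - i%:R) * b - i%:R) * d
    + i%:R * A n.+2 i)%:RE)%E.
  apply: V_le_line => //; first exact: cost_le_G_all.
  apply: (@le_trans _ _ 0); first by apply: mulr_ge0_le0;
    rewrite ?ler0n// subr_le0.
  by apply: mulr_ge0 => //; apply/ltW/Acoef_gt0 => //; exact: leqW.
apply: fhatS_le VL _; rewrite C_under// /Hfun -[n.+2%:R]natr1.
lra.
Qed.

End ChordBounds.

(** * Matching lower bounds *)

Section LowerBounds.
Variables (R : realType) (U b : rat).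
Hypotheses (U_gt0 : 0 < U) (b_gt0 : 0 < b).
Implicit Types (n i k : nat) (x y z d m : rat).
Local Notation A n k := (Acoef U b n (Posz k)).
Local Notation B n k := (Bcoef U b n (Posz k)).
Local Notation fhat := (fhat R U b).
Local Notation ghat := (ghat R U b).
Local Notation V n := (V_of U (fhat n)).
Local Notation "q %:RE" := (ratr q : R)%:E (at level 2, format "q %:RE").

Lemma g_of_ge n x m (v : \bar R) (Q : probability rat R) : fM U m Q ->
  (v <= \int[Q]_(q in ratI U) fhat n x q)%E -> (v <= ghat n x m)%E.
Proof. by move=> QM vQ; apply: le_trans vQ _; exact: ghat_ge_integral. Qed.

Definition cost_ge n := forall x, ratI U x ->
  ((n.+1%:R * x)%:RE <= fhat n.+1 x 0)%E /\
  forall k, (k <= n)%N ->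
    (((n.+1%:R - k%:R) * b * A n.+1 k - b * x)%:RE <= fhat n.+1 x (A n.+1 k))%E.

(** The law on the end points of the chord G_k, with mean m. *)
Definition law_G n k m : probability rat R :=
  two_point R 0 (A n.+1 k) (m / A n.+1 k).

Lemma law_G_spec n k x m : cost_ge n -> (k <= n)%N -> ratI U x ->
  0 <= m <= A n.+1 k ->
  fM U m (law_G n k m) /\
  ((Gfun U b n.+1 k%:Z x m)%:RE <=
     \int[law_G n k m]_(q in ratI U) fhat n.+1 x q)%E.
Proof.
move=> lowC kn xU /andP[m0 mA].
have a0 : 0 < A n.+1 k by apply: Acoef_gt0 => //; exact: leqW.
have p01 : 0 <= m / A n.+1 k <= 1 by exact: div_unit.
split.
  apply: two_point_fM => //; [exact: ratI0 | exact: ratI_A |].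
  by rewrite mulr0 addr0 divfK// gt_eqF.
have [low0 lowA] := lowC x xU.
have -> : Gfun U b n.+1 k%:Z x m =
    m / A n.+1 k * ((n.+1%:R - k%:R) * b * A n.+1 k - b * x)
    + (1 - m / A n.+1 k) * (n.+1%:R * x).
  by rewrite /Gfun -pmulrn; field; rewrite gt_eqF.
apply: two_point_ge => //; [exact: ratI0 | exact: ratI_A | | exact: lowA].
by move=> q; exact: fhat_ge0.
Qed.

(** The law on the end points of the chord H_(j+1), with mean m. *)
Definition law_H n j m : probability rat R :=
  two_point R (A n.+1 j) (A n.+1 j.+1)
    ((m - A n.+1 j) / (A n.+1 j.+1 - A n.+1 j)).

Lemma law_H_spec n j x m : cost_ge n -> (j < n)%N -> ratI U x ->
  A n.+1 j <= m <= A n.+1 j.+1 ->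
  fM U m (law_H n j m) /\
  ((Hfun U b n.+1 j.+1 x m)%:RE <=
     \int[law_H n j m]_(q in ratI U) fhat n.+1 x q)%E.
Proof.
move=> lowC jn xU /andP[m0 mA]; have b0 := b_gt0.
have bj : 0 < b + j.+1%:R by rewrite addr_gt0.
have [e e0 [ajE aE]] : exists2 e, 0 < e &
    A n.+1 j = j.+1%:R * e /\ A n.+1 j.+1 = (b + j.+1%:R) * e.
  exists (A n.+1 j.+1 / (b + j.+1%:R)).
    by rewrite divr_gt0// Acoef_gt0// !leqW.
  split; last by rewrite mulrC divfK// gt_eqF.
  by rewrite -(Acoef_predE U b _ j) Acoef_pred ?leqW// mulrA mulrAC.
have dE : A n.+1 j.+1 - A n.+1 j = b * e by rewrite ajE aE; ring.
have d0 : 0 < A n.+1 j.+1 - A n.+1 j by rewrite dE mulr_gt0.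
have p01 : 0 <= (m - A n.+1 j) / (A n.+1 j.+1 - A n.+1 j) <= 1.
  by apply: div_unit => //; rewrite ?subr_ge0// lerD2r.
split.
  apply: two_point_fM => //; [exact/ratI_A/ltnW | exact: ratI_A |].
  by field; rewrite gt_eqF.
have [_ lowA] := lowC x xU.
have -> : Hfun U b n.+1 j.+1 x m =
    (m - A n.+1 j) / (A n.+1 j.+1 - A n.+1 j) *
      ((n.+1%:R - j.+1%:R) * b * A n.+1 j.+1 - b * x)
    + (1 - (m - A n.+1 j) / (A n.+1 j.+1 - A n.+1 j)) *
      ((n.+1%:R - j%:R) * b * A n.+1 j - b * x).
  rewrite /Hfun dE ajE aE -[j.+1%:R]natr1; field.
  by rewrite !gt_eqF.
apply: two_point_ge => //; [exact/ratI_A/ltnW | exact: ratI_A | | |].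
- by move=> q; exact: fhat_ge0.
- exact/lowA/ltnW.
- exact: lowA.
Qed.

Lemma V_ge n y m (v : \bar R) :
  (forall z, ratI U z -> y <= z -> (v <= ghat n z m)%E) -> (v <= V n y m)%E.
Proof.
by move=> vg; apply: le_ereal_inf_tmp => _ [z [yz zU] <-]; exact: vg.
Qed.

Lemma Acoef_shrink n k : (k <= n)%N -> A n.+2 k <= A n.+1 k.
Proof.
move=> kn; have a0 : 0 < A n.+1 k by apply: Acoef_gt0 => //; exact: leqW.
rewrite Acoef_step ?leqW// ler_piMl ?(ltW a0)//.
by rewrite ler_pdivrMr ?addr_gt0// mul1r lerDr ltW.
Qed.

Lemma ghat_ge0 n x m : ratI U m -> (0 <= ghat n x m)%E.
Proof. by move=> mU; apply: g_of_ge0 => // q; exact: fhat_ge0. Qed.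

Lemma cost_ge_base : cost_ge 0.
Proof.
move=> x xU; have /andP[x0 xtop] := xU; split=> [|k].
  by rewrite fhatS adde0 lee_fin ler_rat C_over// mul1r subr0.
rewrite leqn0 => /eqP->;
  rewrite Acoef_last fhatS adde0 lee_fin ler_rat C_under//.
lra.
Qed.

(** The key point: at m = A_k of the longer horizon the slope of G_k in the
order level vanishes, so every order level costs at least the same amount. *)
Lemma cost_ge_step n : cost_ge n -> cost_ge n.+1.
Proof.
move=> lowC x xU; have /andP[x0 xtop] := xU; split=> [|k kn].
  rewrite fhatS -[n.+2%:R]natr1 mulrDl mul1r addrC rmorphD EFinD.
  rewrite C_over// subr0 leeD2l//; apply: V_ge => z zU xz.
  have [|zM lowz] := law_G_spec lowC (leq0n n) zU (_ : 0 <= 0 <= A n.+1 0).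
    by rewrite lexx ltW// Acoef_gt0.
  apply: le_trans (g_of_ge zM lowz); rewrite lee_fin ler_rat /Gfun !mulr0.
  by rewrite subr0 addr0 ler_pM2l.
rewrite fhatS.
apply: (@le_trans _ _ ((b * (A n.+2 k - x))%:RE +
    ((n.+1%:R - k%:R) * b * A n.+2 k)%:RE)%E).
  rewrite -EFinD -rmorphD lee_fin ler_rat -[n.+2%:R]natr1; lra.
apply: leeD; first by rewrite lee_fin ler_rat; exact: C_ge_under.
have AU : ratI U (A n.+2 k) by exact: ratI_A.
apply: V_ge => z zU _; move: kn; rewrite leq_eqVlt => /predU1P[->|kn].
  by rewrite subrr !mul0r rmorph0; apply: ghat_ge0; exact: ratI_A.
have /andP[A0 _] := AU.
have [|zM lowz] := law_G_spec lowC kn zU (_ : 0 <= A n.+2 k <= A n.+1 k).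
  by rewrite A0 Acoef_shrink.
apply: le_trans (g_of_ge zM lowz); rewrite lee_fin ler_rat /Gfun -pmulrn.
have a0 : 0 < A n.+1 k by apply: Acoef_gt0 => //; exact: leqW.
rewrite {2}Acoef_step ?leqW//.
have -> : (b + n.+1%:R) / A n.+1 k *
    (n.+1%:R / (b + n.+1%:R) * A n.+1 k) = n.+1%:R.
  by field; rewrite nat1r !gt_eqF// addr_gt0.
by rewrite subrr mul0r add0r.
Qed.

Lemma cost_ge_all n : cost_ge n.
Proof. by elim: n => [|n]; [exact: cost_ge_base | exact: cost_ge_step]. Qed.

End LowerBounds.

(** * The worst-case law and the optimal base-stock level *)

Section OnePeriod.
Variables (R : realType) (U b : rat).
Hypotheses (U_gt0 : 0 < U) (b_gt0 : 0 < b).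
Implicit Types (n i k : nat) (x y z d m : rat).
Local Notation A n k := (Acoef U b n (Posz k)).
Local Notation B n k := (Bcoef U b n (Posz k)).
Local Notation fhat := (fhat R U b).
Local Notation ghat := (ghat R U b).
Local Notation V n := (V_of U (fhat n)).
Local Notation "q %:RE" := (ratr q : R)%:E (at level 2, format "q %:RE").

Let le_G n := ghat_le_G U_gt0 b_gt0 (@cost_le_G_all R U b U_gt0 b_gt0 n).
Let le_H n := ghat_le_H U_gt0 b_gt0 (@cost_le_H_all R U b U_gt0 b_gt0 n).
Let G_spec n k x m :=
  @law_G_spec R U b U_gt0 b_gt0 n k x m (cost_ge_all R U_gt0 b_gt0 n).
Let H_spec n j x m :=
  @law_H_spec R U b U_gt0 b_gt0 n j x m (cost_ge_all R U_gt0 b_gt0 n).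

Lemma ghat_ge_G n k x m : (k <= n)%N -> ratI U x -> 0 <= m <= A n.+1 k ->
  ((Gfun U b n.+1 k%:Z x m)%:RE <= ghat n.+1 x m)%E.
Proof.
move=> kn xU mA.
have [QM QG] := G_spec kn xU mA.
exact: g_of_ge QM QG.
Qed.

Lemma ghat_ge_H n j x m : (j < n)%N -> ratI U x ->
  A n.+1 j <= m <= A n.+1 j.+1 ->
  ((Hfun U b n.+1 j.+1 x m)%:RE <= ghat n.+1 x m)%E.
Proof.
move=> jn xU mA.
have [QM QH] := H_spec jn xU mA.
exact: g_of_ge QM QH.
Qed.

Lemma ratI_split x : ratI U x -> x = U \/ 0 <= x < U.
Proof.
by move=> /andP[x0]; rewrite le_eqVlt => /predU1P[->|xU]; [left|right;
  rewrite x0].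
Qed.

Lemma piece_exists n x : ratI U x ->
  exists2 k, (k <= n)%N & B n.+1 k <= x <= B n.+1 k.+1.
Proof.
move=> /ratI_split[->|/andP[x0 xU]].
  by exists n => //; rewrite Bcoef_top// lexx andbT Bcoef_leU.
have [k kn /andP[k1 k2]] := Bcoef_bracket b_gt0 n x0 xU.
by exists k => //; rewrite k1 ltW.
Qed.

(** The number v is the value at m of a chord that majorizes the cost and whose
end points carry the law q. *)
Lemma qlaw_optimal n x m : ratI U x -> ratI U m ->
  exists v : \bar R, [/\ fM U m (qlaw R U b n.+1 x m),
    (v <= \int[qlaw R U b n.+1 x m]_(q in ratI U) fhat n.+1 x q)%E &
    (ghat n.+1 x m <= v)%E].
Proof.
move=> xU mU; have /andP[m0 mtop] := mU; have /andP[x0 xtop] := xU.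
rewrite /qlaw; case: ifPn => [/orP[/eqP mE|/eqP xE]|/norP[mN xN]].
- (* at mean 0 all mass is at 0, where every chord G_k has the same value *)
  have [k kn kB] := piece_exists n xU.
  exists (Gfun U b n.+1 k%:Z x m)%:RE.
  have [|QM QG] := G_spec (leqnn n) xU (_ : 0 <= m <= A n.+1 n).
    by rewrite m0 Acoef_last.
  move: QM QG; rewrite /law_G Acoef_last => QM QG; split => //;
    last exact: le_G.
  by apply: le_trans QG; rewrite /Gfun mE !mulr0 lexx.
- exists (Gfun U b n.+1 n%:Z x m)%:RE.
  have [|QM QG] := G_spec (leqnn n) xU (_ : 0 <= m <= A n.+1 n).
    by rewrite m0 Acoef_last.
  move: QM QG; rewrite /law_G Acoef_last => QM QG; split => //;
    apply: le_G => //.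
  by rewrite xE Bcoef_top// lexx andbT Bcoef_leU.
have {mN} m_gt0 : 0 < m by rewrite lt0r mN.
have {xN} x_ltU : x < U by rewrite lt_neqAle xN.
case: pickP => [i /andP[mlo mhi]|/= noi]; last first.
  have [i iln iA] := Acoef_bracket b_gt0 n m_gt0 mtop.
  by have := noi (inord i); rewrite inordK ?iA// ltnS leqW.
have iln : (i <= n)%N.
  move: (ltn_ord i); rewrite ltnS leq_eqVlt => /predU1P[iE|//].
  by move: mlo; rewrite iE Acoef_predE Acoef_last ltNge mtop.
case: ifPn => [xB|]; last rewrite -leNgt => xB.
  case: i mlo mhi iln xB => -[|j] /= jlt mlo mhi jn xB.
    by move: xB; rewrite Bcoef0 ltNge x0.
  move: mlo; rewrite Acoef_predE => mlo.
  have [|QM QH] := H_spec jn xU (_ : A n.+1 j <= m <= A n.+1 j.+1).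
    by rewrite (ltW mlo).
  exists (Hfun U b n.+1 j.+1 x m)%:RE; split => //.
  by apply: le_H => //; exact: ltW.
case: pickP => [k /andP[ik /andP[k1 k2]]|/= nok]; last first.
  have [k kn /andP[k1 k2]] := Bcoef_bracket b_gt0 n x0 x_ltU.
  have := nok (inord k); rewrite inordK// addrC -PoszD add1n k1 k2 !andbT.
  move=> /negbT; rewrite -ltnNge => ki.
  have kin : (k.+1 <= i <= n.+1)%N by rewrite ki leqW.
  by have := Bcoef_le U_gt0 b_gt0 kin; rewrite leNgt (le_lt_trans xB k2).
have kn : (k <= n)%N by rewrite -ltnS.
have mA : 0 <= m <= A n.+1 k.
  by rewrite m0 (le_trans mhi)// Acoef_le// ik.
have [QM QG] := G_spec kn xU mA.
exists (Gfun U b n.+1 (k : nat)%:Z x m)%:RE; split => //; apply: le_G => //.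
by move: k2; rewrite addrC -PoszD add1n => /ltW ->; rewrite k1.
Qed.

(** The bounds on m are those that fix the signs of the slopes of G_i and
G_(i-1); for m = 0 the index is 0 and there is no bound from below. *)
Lemma Gam_spec n m : ratI U m ->
  exists i : nat, [/\ (i <= n.+1)%N, Gam U b n.+1 m = i%:Z, m <= A n.+2 i &
    ((0 < i)%N -> A n.+2 i.-1 <= m)].
Proof.
move=> /andP[m0 mtop]; rewrite /Gam; case: ifPn => [/eqP->|mN].
  by exists 0%N; split => //; exact/ltW/Acoef_gt0.
have {mN} m_gt0 : 0 < m by rewrite lt0r mN.
case: pickP => [i /andP[mlo mhi]|/= noi].
  exists i; split => //; first by rewrite -ltnS.
  by case: i mlo {mhi} => -[//|j] jlt /=; rewrite Acoef_predE => /ltW.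
have [i iln iA] := Acoef_bracket b_gt0 n.+1 m_gt0 mtop.
by have := noi (inord i); rewrite inordK ?iA// ltnS.
Qed.

Lemma chi_ratI n m : ratI U m -> ratI U (chi U b n.+1 m).
Proof. by move=> /(Gam_spec n)[i [iln iE _ _]]; rewrite /chi iE;
  exact: ratI_B. Qed.

Lemma max_chi_ratI n y m : y <= U -> ratI U m ->
  ratI U (Num.max y (chi U b n.+1 m)).
Proof.
move=> yU /(chi_ratI n) /andP[c0 cU]; apply/andP; split.
  by rewrite le_max c0 orbT.
by rewrite ge_max yU.
Qed.

Lemma Gfun_mono n k m x x' : (k <= n)%N -> m <= A n.+2 k -> x <= x' ->
  Gfun U b n.+1 k%:Z x m <= Gfun U b n.+1 k%:Z x' m.
Proof.
move=> kn mA xx'; rewrite /Gfun lerD2r; apply: ler_wpM2l => //.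
have a0 : 0 < A n.+1 k by apply: Acoef_gt0 => //; exact: leqW.
have bn : 0 < b + n.+1%:R by rewrite addr_gt0.
rewrite subr_ge0 mulrAC ler_pdivrMr// mulrC -ler_pdivlMr//.
by move: mA; rewrite Acoef_step ?leqW// mulrAC.
Qed.

Lemma Gfun_anti n k m x x' : (k <= n)%N -> A n.+2 k <= m -> x <= x' ->
  Gfun U b n.+1 k%:Z x' m <= Gfun U b n.+1 k%:Z x m.
Proof.
move=> kn mA xx'; rewrite /Gfun lerD2r; apply: ler_wnM2l => //.
have a0 : 0 < A n.+1 k by apply: Acoef_gt0 => //; exact: leqW.
have bn : 0 < b + n.+1%:R by rewrite addr_gt0.
rewrite subr_le0 mulrAC ler_pdivlMr// [leRHS]mulrC -ler_pdivrMr//.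
by move: mA; rewrite Acoef_step ?leqW// mulrAC.
Qed.

(** To the right of the chosen level the affine minorant is G_k with k at least
the index of chi, which is nondecreasing. To the left it is G_(i-1), or H_i
when m exceeds A_(i-1); both are nonincreasing. *)
Lemma chi_optimal n y w m : y <= U -> ratI U m -> y <= w -> ratI U w ->
  (ghat n.+1 (Num.max y (chi U b n.+1 m)) m <= ghat n.+1 w m)%E.
Proof.
move=> yU mU yw wU; have zU := max_chi_ratI n yU mU.
have [i [iln iE mhi mlo]] := Gam_spec n mU.
have /andP[m0 mtop] := mU; have /andP[w0 wtop] := wU.
set z := Num.max _ _ in zU *.
have cE : chi U b n.+1 m = B n.+1 i by rewrite /chi iE.
case: (lerP z w) => zw.
  case: (ratI_split zU) => [zE|/andP[z0 zltU]].
    suff -> : w = z by [].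
    by apply/le_anti; rewrite zw zE wtop.
  have [k kn /andP[k1 k2]] := Bcoef_bracket b_gt0 n z0 zltU.
  have ik : (i <= k)%N.
    rewrite leqNgt; apply/negP => ki;
      have kin : (k.+1 <= i <= n.+1)%N by rewrite ki.
    have := Bcoef_le U_gt0 b_gt0 kin; rewrite leNgt => /negP[].
    by apply: le_lt_trans k2; rewrite -cE /z le_max lexx orbT.
  have mk : m <= A n.+2 k by apply: le_trans mhi _; apply: Acoef_le => //;
    rewrite ik leqW.
  apply: (@le_trans _ _ (Gfun U b n.+1 k%:Z z m)%:RE).
    by apply: le_G => //; rewrite k1 ltW.
  apply: (@le_trans _ _ (Gfun U b n.+1 k%:Z w m)%:RE).
    by rewrite lee_fin ler_rat; exact: Gfun_mono.
  apply: ghat_ge_G => //; rewrite m0 (le_trans mk)//; exact: Acoef_shrink.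
have zE : z = B n.+1 i.
  by move: zw; rewrite /z lt_max ltNge yw/= -cE => /ltW wc;
    rewrite max_r// (le_trans yw).
case: i iln iE mhi mlo cE zE => [|j] jn iE mhi mlo cE zE.
  by move: zw; rewrite zE Bcoef0 ltNge w0.
have {}mlo : A n.+2 j <= m := mlo isT.
have jn' : (j <= n)%N by [].
case: (lerP m (A n.+1 j)) => mj.
  apply: (@le_trans _ _ (Gfun U b n.+1 j%:Z z m)%:RE).
    by apply: le_G => //; rewrite zE lexx andbT Bcoef_le// leqnSn.
  apply: (@le_trans _ _ (Gfun U b n.+1 j%:Z w m)%:RE).
    by rewrite lee_fin ler_rat; apply: Gfun_anti => //; exact: ltW.
  by apply: ghat_ge_G => //; rewrite m0.
have jn1 : (j < n)%N.
  rewrite ltn_neqAle jn' andbT; apply: contraTneq mj => ->.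
  by rewrite Acoef_last -leNgt.
apply: (@le_trans _ _ (Hfun U b n.+1 j.+1 z m)%:RE).
  by apply: le_H => //; rewrite zE.
apply: (@le_trans _ _ (Hfun U b n.+1 j.+1 w m)%:RE).
  by rewrite lee_fin ler_rat /Hfun lerD2l lerN2 ler_pM2l// ltW.
apply: ghat_ge_H => //; rewrite (ltW mj)/=.
by apply: le_trans mhi _; exact: Acoef_shrink.
Qed.

(** When chi = U the index is n + 1, one beyond the last piece; there G_(n+1)
and G_n agree at U. *)
Lemma ghat_chi n m : ratI U m ->
  ghat n.+1 (chi U b n.+1 m) m = (Opt U b n.+1 m)%:RE.
Proof.
move=> mU; have [i [iln iE mhi mlo]] := Gam_spec n mU.
have /andP[m0 mtop] := mU.
rewrite /Opt /chi iE; move: iln; rewrite leq_eqVlt => /predU1P[iT|iln].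
  have GE : Gfun U b n.+1 n.+1%:Z U m = Gfun U b n.+1 n%:Z U m.
    have bn : 0 < b + n.+1%:R by rewrite addr_gt0.
    rewrite /Gfun Acoef_last Acoef_top -!pmulrn -[n.+1%:R]natr1; field.
    by rewrite !natr1 pnatr_eq0/= !gt_eqF.
  rewrite iT Bcoef_top// GE; apply/le_anti/andP; split.
    apply: le_G => //; first exact: ratI_top.
    by rewrite Bcoef_top// lexx andbT Bcoef_leU.
  by apply: ghat_ge_G => //; [exact: ratI_top | rewrite m0 Acoef_last].
have BU : ratI U (B n.+1 i) by apply: ratI_B => //; exact: leqW.
apply/le_anti/andP; split.
  by apply: le_G => //; rewrite lexx Bcoef_le// leqnSn ltnS.
by apply: ghat_ge_G => //; rewrite m0 (le_trans mhi)// Acoef_shrink.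
Qed.

Lemma V_max_chi n y m : y <= U -> ratI U m ->
  V n.+1 y m = ghat n.+1 (Num.max y (chi U b n.+1 m)) m.
Proof.
move=> yU mU; apply/le_anti/andP; split.
  by apply: V_le_ghat; [rewrite le_max lexx | exact: max_chi_ratI].
by apply: V_ge => z zU yz; exact: chi_optimal.
Qed.

End OnePeriod.

(** A chord that touches the concave envelope g(x, .) at m. The case
distinction is that of the law q. *)
Lemma supergradient (R : realType) (U b : rat) (n : nat) (x m : rat) :
  0 < U -> 0 < b -> ratI U x -> ratI U m ->
  exists al be : rat,
    (forall q, ratI U q ->
       (fhat R U b n.+1 x q <= (ratr (al + be * q) : R)%:E)%E) /\
    ((ratr (al + be * m) : R)%:E <= ghat R U b n.+1 x m)%E.
Proof.
move=> U_gt0 b_gt0 xU mU; have /andP[m0 mtop] := mU.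
have [k kn kB] := piece_exists U_gt0 b_gt0 n xU.
have a0 : 0 < Acoef U b n.+1 k%:Z by apply: Acoef_gt0 => //; exact: leqW.
have [mk|mk] := lerP m (Acoef U b n.+1 k%:Z).
  exists (n.+1%:R * x).
  exists ((n.+1%:R - k%:R) * b - (b + n.+1%:R) / Acoef U b n.+1 k%:Z * x).
  split=> [q qU|]; rewrite -Gfun_affine; first exact: cost_le_G_all.
  by apply: ghat_ge_G => //; rewrite m0.
have [i iln /andP[ilo ihi]] := Acoef_bracket b_gt0 n (lt_trans a0 mk) mtop.
case: i iln ilo ihi => [|j] jn + ihi.
  move=> _; have := Acoef_le U_gt0 b_gt0 (_ : 0 <= k <= n)%N.
  by rewrite leq0n kn => /(_ isT); rewrite leNgt (lt_le_trans mk ihi).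
rewrite Acoef_predE => jlo.
exists (j.+1%:R * Acoef U b n.+1 j.+1%:Z - b * x).
exists ((n.+1%:R - j.+1%:R) * b - j.+1%:R).
split=> [q qU|]; rewrite -Hfun_affine.
  2: by apply: ghat_ge_H => //; rewrite (ltW jlo).
apply: cost_le_H_all => //; have /andP[_ kB2] := kB; apply: le_trans kB2 _.
have kj : (k <= j)%N.
  rewrite leqNgt; apply/negP => jk; have jkn : (j.+1 <= k <= n)%N by rewrite jk.
  by have := Acoef_le U_gt0 b_gt0 jkn; rewrite leNgt (lt_le_trans mk ihi).
by apply: Bcoef_le => //; rewrite ltnS kj leqW.
Qed.

Local Notation coord := Defs.coord.

(** * Demand prefixes *)

Section Cylinders.
Variables (R : realType) (U : rat) (T : nat).
Implicit Types (t : nat) (D : T.-tuple rat) (Q : probability (T.-tuple rat) R).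
Local Notation Box := (box U T).
Local Notation "q %:RE" := (ratr q : R)%:E (at level 2, format "q %:RE").

Definition cylinder t (d : seq rat) : set (T.-tuple rat) :=
  [set D | take t D = d :> seq rat].

Lemma coord_take t s (d : seq rat) : (0 < s <= t)%N ->
  coord s (take t d) = coord s d.
Proof. by case/andP; case: s => // s _ st; rewrite /coord nth_take. Qed.

Lemma box_take t D (d : t.-tuple rat) : (t <= T)%N -> Box D ->
  cylinder t d D -> box U t d.
Proof.
move=> tT bD dE s /andP[s0 st]; rewrite -dE coord_take ?s0//.
by apply: bD; rewrite s0 (leq_trans st).
Qed.

Lemma box_coord t D : (0 < t <= T)%N -> Box D -> ratI U (coord t D).
Proof. by move=> tT; exact. Qed.

Lemma integral_box Q (E : set (T.-tuple rat)) (f : T.-tuple rat -> \bar R) :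
  Q Box = 1%E ->
  (\int[Q]_(D in E) f D = \int[Q]_(D in E `&` Box) f D)%E.
Proof.
move=> Q1; have QC : Q (~` Box) = 0%E.
  by rewrite probability_setC ?Q1 ?subee//; exact: measurable_rat_tuple.
have mT := @measurable_rat_tuple T.
rewrite -{1}(setIT E) -(setUv Box) setIUr integral_setU//.
  rewrite (@null_set_integral _ _ _ _ (E `&` ~` Box)) ?adde0//.
  apply/eqP; rewrite -measure_le0 -QC; apply: le_measure; rewrite ?inE//.
by apply/disj_setPS => D [[_ ?] [_ ?]].
Qed.

(** The next demand leaves [0, U] with probability zero, so f can be cut off
there without changing either side. *)
Lemma integral_next Q t (d : t.-tuple rat) (q : probability rat R)
    (f : rat -> \bar R) : Q Box = 1%E -> (t < T)%N ->
  (forall A, Q [set D | cylinder t d D /\ A (coord t.+1 D)]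
             = (Q (cylinder t d) * q A)%E) ->
  (forall z, ratI U z -> (0 <= f z)%E) -> q (ratI U) = 1%E ->
  (\int[Q]_(D in cylinder t d `&` Box) f (coord t.+1 D) =
     Q (cylinder t d) * \int[q]_(z in ratI U) f z)%E.
Proof.
move=> Q1 tT law f0 q1.
pose g z := if 0 <= z <= U then f z else 0%E.
have g0 z : (0 <= g z)%E by rewrite /g; case: ifP => // /f0.
transitivity (\int[Q]_(D in cylinder t d) g (coord t.+1 D))%E.
  rewrite [RHS]integral_box//; apply: eq_integral => D /set_mem[_ bD].
  by rewrite /g ifT//; apply: box_coord bD.
rewrite (@integral_scaled_law R _ _ (@measurable_rat_tuple T) Q (cylinder t d)
  (coord t.+1) q (Q (cylinder t d)) g)//.
congr (_ * _)%E; rewrite -(integral_ratI g q1).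
by apply: eq_integral => z /set_mem zU; rewrite /g ifT.
Qed.

Lemma le_integral_cylinders Q t (F G : T.-tuple rat -> \bar R) : (t <= T)%N ->
  (forall D, Box D -> (0 <= F D)%E) -> (forall D, Box D -> (0 <= G D)%E) ->
  (forall d : t.-tuple rat, box U t d ->
     (\int[Q]_(D in cylinder t d `&` Box) F D
       <= \int[Q]_(D in cylinder t d `&` Box) G D)%E) ->
  (\int[Q]_(D in Box) F D <= \int[Q]_(D in Box) G D)%E.
Proof.
move=> tT F0 G0 FG; have mT := @measurable_rat_tuple T.
apply: (@le_integral_fibers R _ _ _ _ (seq rat) mT mT Q Q Box Box
  (fun D => take t D) (fun D => take t D) F G) => // e.
rewrite setIC -[[set _ | _]]/(cylinder t e).
have [->|/set0P[D [De bD]]] := eqVneq (cylinder t e `&` Box) set0.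
  by rewrite !integral_set0.
have et : size e == t by rewrite -De size_takel// size_tuple.
rewrite -[e]/(tval (Tuple et)); apply: FG.
exact: (@box_take t D (Tuple et) tT bD De).
Qed.

End Cylinders.

(** * Expected cost-to-go along a policy *)

Definition stock (x0 : rat) (pi : policy) (t : nat) (d : seq rat) : rat :=
  if t is s.+1 then pi t (take s d) - coord t d else x0.

Definition last_demand (mu : rat) (t : nat) (d : seq rat) : rat :=
  if t is 0%N then mu else coord t d.

Definition prefix_cost (b : rat) (pi : policy) (t : nat) (d : seq rat) : rat :=
  \sum_(1 <= s < t.+1) C b (pi s (take s.-1 d)) (coord s d).

Section Verification.
Variables (R : realType) (U b mu x0 : rat) (T : nat) (pi : policy).
Hypotheses (U_gt0 : 0 < U) (b_gt0 : 0 < b) (mu_in : ratI U mu).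
Implicit Types (t : nat) (D : T.-tuple rat) (Q : probability (T.-tuple rat) R).
Local Notation Box := (box U T).
Local Notation "q %:RE" := (ratr q : R)%:E (at level 2, format "q %:RE").
Local Notation fhat := (fhat R U b).
Local Notation ghat := (ghat R U b).
Local Notation cyl := (@cylinder T).

(** The cost of the first t periods plus the optimal cost of the others. It
interpolates between the value of the dynamic program (t = 0) and the total
cost of the policy (t = T). *)
Definition value t D : \bar R :=
  ((prefix_cost b pi t D)%:RE
   + cost_to_go R U b (T - t) (stock x0 pi t D) (last_demand mu t D))%E.

(** The martingale property together with the mean of D_1, in one formula
thanks to [last_demand]. *)
Definition mean_preserving Q := forall t (d : t.-tuple rat), (t < T)%N ->
  box U t d ->
  (\int[Q]_(D in cyl t d `&` Box) (coord t.+1 D)%:RE =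
     (last_demand mu t d)%:RE * Q (cyl t d `&` Box))%E.

Lemma prefix_cost_ge0 t (d : seq rat) : 0 <= prefix_cost b pi t d.
Proof. by apply: sumr_ge0 => s _; exact: C_ge0. Qed.

Lemma cost_to_go_ge0 n y m : ratI U m -> (0 <= cost_to_go R U b n y m)%E.
Proof.
move=> mU; case: n => [//|n]; apply: V_ge => z _ _; exact: ghat_ge0.
Qed.

Lemma last_demand_ratI t (d : seq rat) : ((0 < t)%N -> ratI U (coord t d)) ->
  ratI U (last_demand mu t d).
Proof. by case: t => // t; apply. Qed.

Lemma last_demand_box t (d : seq rat) :
  (forall s, (1 <= s <= t)%N -> ratI U (coord s d)) ->
  ratI U (last_demand mu t d).
Proof. by move=> bd; apply: last_demand_ratI => t0; apply: bd;
  rewrite t0 leqnn. Qed.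

Lemma value_ge0 t D : (t <= T)%N -> Box D -> (0 <= value t D)%E.
Proof.
move=> tT bD; rewrite /value adde_ge0//;
  first by rewrite lee_fin ler0q prefix_cost_ge0.
by apply: cost_to_go_ge0; apply: last_demand_ratI => t0; apply: bD; rewrite t0.
Qed.

Lemma prefix_cost_take t (d : seq rat) :
  prefix_cost b pi t (take t d) = prefix_cost b pi t d.
Proof.
apply: eq_big_nat => s /andP[s1 st].
rewrite coord_take ?s1//; congr (C b (pi s _) _).
by rewrite take_takel//; case: s s1 st => // s _; rewrite ltnS => /ltnW.
Qed.

Lemma stock_take t (d : seq rat) : stock x0 pi t (take t d) = stock x0 pi t d.
Proof. by case: t => // t; rewrite /stock take_takel// coord_take//=. Qed.

Lemma last_demand_take t (d : seq rat) :
  last_demand mu t (take t d) = last_demand mu t d.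
Proof. by case: t => // t; rewrite /last_demand coord_take//=. Qed.

Lemma value_before t (d : t.-tuple rat) D : cyl t d D ->
  value t D = ((prefix_cost b pi t d)%:RE
   + cost_to_go R U b (T - t) (stock x0 pi t d) (last_demand mu t d))%E.
Proof.
by move=> dE; rewrite -dE prefix_cost_take stock_take last_demand_take.
Qed.

Lemma value_after t (d : t.-tuple rat) D : (t < T)%N -> cyl t d D ->
  value t.+1 D = ((prefix_cost b pi t d)%:RE
    + fhat (T - t) (pi t.+1 d) (coord t.+1 D))%E.
Proof.
move=> tT dE; rewrite -(subnSK tT) fhatS -dE prefix_cost_take addeA -EFinD.
by rewrite -rmorphD /value /prefix_cost big_nat_recr//=.
Qed.

(** Splits off the cost paid so far, a constant on the cylinder. *)
Lemma integral_shift Q t (d : t.-tuple rat) (c : rat) (F : T.-tuple rat -> \bar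
  R) :
  0 <= c -> (forall D, Box D -> (0 <= F D)%E) ->
  (\int[Q]_(D in cyl t d `&` Box) (c%:RE + F D) =
    c%:RE * Q (cyl t d `&` Box) + \int[Q]_(D in cyl t d `&` Box) F D)%E.
Proof.
move=> c0 F0; have mT := @measurable_rat_tuple T.
rewrite ge0_integralD//.
- by rewrite integral_cst.
- by move=> D _; rewrite lee_fin ler0q.
- by move=> D [_ bD]; exact: F0.
Qed.

(** Conditionally on the past, bound the next cost by a chord touching at the
last demand: the martingale property makes the chord worth exactly g there, and
the base-stock level makes g equal to V. *)
Lemma value_step_le Q t : (t < T)%N -> mean_preserving Q ->
  (forall d : t.-tuple rat, box U t d -> stock x0 pi t d <= U /\
     pi t.+1 d = Num.max (stock x0 pi t d) (chi U b (T - t) (last_demand mu t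
       d))) ->
  (\int[Q]_(D in Box) value t.+1 D <= \int[Q]_(D in Box) value t D)%E.
Proof.
move=> tT mQ piE; apply: (le_integral_cylinders (ltnW tT)).
- by move=> D; exact: value_ge0.
- by move=> D; exact/value_ge0/ltnW.
move=> d bd; have [sU {}piE] := piE d bd.
have mT := @measurable_rat_tuple T.
have mU := last_demand_box bd.
have [n nE] : exists n, (T - t)%N = n.+1.
  by exists (T - t.+1)%N; rewrite subnSK.
have zU : ratI U (pi t.+1 d) by rewrite piE nE; exact: max_chi_ratI.
rewrite (eq_integral (fun D => ((prefix_cost b pi t d)%:RE
    + fhat (T - t) (pi t.+1 d) (coord t.+1 D))%E)); last first.
  by move=> D /set_mem[dE _]; exact: value_after.
rewrite [leRHS](eq_integral (fun D => ((prefix_cost b pi t d)%:RE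
    + cost_to_go R U b (T - t) (stock x0 pi t d) (last_demand mu t d))%E));
      last first.
  by move=> D /set_mem[dE _]; exact: value_before.
have coordU D : Box D -> ratI U (coord t.+1 D) by move=> bD; exact: bD.
rewrite !integral_shift ?prefix_cost_ge0//; last 2 first.
- by move=> D _; exact: cost_to_go_ge0.
- by move=> D /coordU; exact: fhat_ge0.
apply: leeD2l; rewrite integral_cst// nE /cost_to_go V_max_chi// -nE -piE nE.
have [al [be [line tangent]]] := supergradient R n U_gt0 b_gt0 zU mU.
apply: (@le_trans _ _ ((ratr (al + be * last_demand mu t d) : R)%:E *
    Q (cyl t d `&` Box))%E); last exact: lee_wpmul2r.
apply: (le_integral_line mT (Z := coord t.+1) (U := U)).
- by move=> D [_ /coordU].
- exact: mQ.
- by move=> D [_ /coordU]; exact: fhat_ge0.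
- by move=> D [_ /coordU]; exact: line.
Qed.

(** The conditional law of the next demand is q, stated as a product so that
prefixes of mass zero need no exception. *)
Definition adversarial Q :=
  forall t (d : t.-tuple rat) (A : set rat), (t < T)%N ->
  Q [set D | cyl t d D /\ A (coord t.+1 D)] =
  (Q (cyl t d) * qlaw R U b (T - t) (pi t.+1 d) (last_demand mu t d) A)%E.

Hypothesis pi_ratI : forall t (d : t.-tuple rat), (t < T)%N -> box U t d ->
  ratI U (pi t.+1 d).

Lemma value_step_ge Q t : (t < T)%N -> Q Box = 1%E -> adversarial Q ->
  (forall d : t.-tuple rat, box U t d -> stock x0 pi t d <= pi t.+1 d) ->
  (\int[Q]_(D in Box) value t D <= \int[Q]_(D in Box) value t.+1 D)%E.
Proof.
move=> tT Q1 advQ piS; apply: (le_integral_cylinders (ltnW tT)).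
- by move=> D; exact/value_ge0/ltnW.
- by move=> D; exact: value_ge0.
move=> d bd.
have mT := @measurable_rat_tuple T.
have mU := last_demand_box bd.
have [n nE] : exists n, (T - t)%N = n.+1.
  by exists (T - t.+1)%N; rewrite subnSK.
have zU := pi_ratI tT bd.
rewrite (eq_integral (fun D => ((prefix_cost b pi t d)%:RE
    + cost_to_go R U b (T - t) (stock x0 pi t d) (last_demand mu t d))%E));
      last first.
  by move=> D /set_mem[dE _]; exact: value_before.
rewrite [leRHS](eq_integral (fun D => ((prefix_cost b pi t d)%:RE
    + fhat (T - t) (pi t.+1 d) (coord t.+1 D))%E)); last first.
  by move=> D /set_mem[dE _]; exact: value_after.
have coordU D : Box D -> ratI U (coord t.+1 D) by move=> bD; exact: bD.
rewrite !integral_shift ?prefix_cost_ge0//; last 2 first.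
- by move=> D /coordU; exact: fhat_ge0.
- by move=> D _; exact: cost_to_go_ge0.
apply: leeD2l; rewrite integral_cst//.
have [v [[qU qm] vq gv]] := qlaw_optimal R U_gt0 b_gt0 n zU mU.
rewrite (@integral_next R U T Q t d (qlaw R U b (T - t) (pi t.+1 d)
  (last_demand mu t d))
  (fhat (T - t) (pi t.+1 d)))//; last 3 first.
- by move=> A; exact: advQ.
- by move=> z; exact: fhat_ge0.
- by rewrite nE.
have QE : Q (cyl t d `&` Box) = Q (cyl t d).
  have := @integral_box R U T Q (cyl t d) (cst 1%E) Q1.
  by rewrite !integral_cst// !mul1e.
rewrite [X in (_ * X <= _)%E]QE muleC nE; apply: lee_wpmul2l => //.
apply: le_trans vq; apply: le_trans gv.
exact: V_le_ghat (piS d bd) zU.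
Qed.

Lemma mass_box Q (E : set (T.-tuple rat)) : Q Box = 1%E -> Q (E `&` Box) = Q E.
Proof.
move=> Q1; have mT := @measurable_rat_tuple T.
have := @integral_box R U T Q E (cst 1%E) Q1.
by rewrite !integral_cst// !mul1e.
Qed.

(** By induction on the prefix: the law q is concentrated on [0, U] as long as
the past is in the box. *)
Lemma adversarial_box Q : adversarial Q -> Q Box = 1%E.
Proof.
move=> advQ; have mT := @measurable_rat_tuple T.
pose P t : set (T.-tuple rat) :=
  [set D | forall s, (1 <= s <= t)%N -> ratI U (coord s D)].
suff H t : (t <= T)%N -> Q (~` P t) = 0%E.
  have := probability_setC Q (mT (~` P T)).
  by rewrite setCK [X in (1 - X)%E]H// sube0.
elim: t => [_|t IH tT].
  rewrite (_ : ~` P 0%N = set0) ?measure0//.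
  by apply/seteqP; split=> // D; apply => s; case: s.
pose N : set (T.-tuple rat) := P t `&` [set D | ~ ratI U (coord t.+1 D)].
have N0 : Q N = 0%E.
  apply/eqP; rewrite -measure_le0.
  rewrite -[leLHS]mul1e -integral_cst// -[leRHS](integral_set0 Q (cst 1%E)).
  apply: (@le_integral_fibers R _ _ _ _ (seq rat) mT mT Q Q N set0
    (fun D => take t D) (fun D => take t D)) => // e.
  rewrite set0I integral_set0 integral_cst// mul1e.
  have [->|/set0P[D [[PD _] De]]] := eqVneq (N `&` [set D | take t D = e]) set0.
    by rewrite measure0.
  have et : size e == t by rewrite -De size_takel ?size_tuple// ltnW.
  have be : box U t (Tuple et).
    move=> s /andP[s0 st]; rewrite -[tval _]/e -De coord_take ?s0//.
    by apply: PD; rewrite s0.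
  have [n nE] : exists n, (T - t)%N = n.+1.
    by exists (T - t.+1)%N; rewrite subnSK.
  have mU := last_demand_box be.
  have [v [[qU _] _ _]] := qlaw_optimal R U_gt0 b_gt0 n (pi_ratI tT be) mU.
  apply: (@le_trans _ _ (Q [set D | cyl t (Tuple et) D /\
      [set z | ~ ratI U z] (coord t.+1 D)])).
    by apply: le_measure; rewrite ?inE// => D' [[_ ?] ?].
  rewrite advQ// nE probability_setC// [X in (1 - X)%E]qU subee// mule0.
  exact: lexx.
rewrite (_ : ~` P t.+1 = ~` P t `|` N).
  apply/eqP; rewrite -measure_le0 (le_trans (measureU2 _ _ _))//.
  by rewrite [X in (X + _)%E]IH ?(ltnW tT)// add0e [leLHS]N0.
apply/seteqP; split=> D /=.
  move=> nP; have [PtD|] := pselect (P t D); last by left.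
  right; split=> // cU; apply: nP => s /andP[s0].
  rewrite leq_eqVlt => /predU1P[->//|]; rewrite ltnS => st.
  by apply: PtD; rewrite s0.
move=> [nP PD|[PD nU] PD']; last by apply: nU; apply: PD'; rewrite leqnn.
by apply: nP => s /andP[s0 st]; apply: PD; rewrite s0 leqW.
Qed.

Lemma adversarial_mean Q : adversarial Q -> mean_preserving Q.
Proof.
move=> advQ; have Q1 := adversarial_box advQ.
move=> t d tT bd.
have mU := last_demand_box bd.
have [n nE] : exists n, (T - t)%N = n.+1.
  by exists (T - t.+1)%N; rewrite subnSK.
have [v [[qU qm] _ _]] := qlaw_optimal R U_gt0 b_gt0 n (pi_ratI tT bd) mU.
rewrite (@integral_next R U T Q t d (qlaw R U b (T - t) (pi t.+1 d)
  (last_demand mu t d))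
  (fun q => (ratr q : R)%:E))//; last 3 first.
- by move=> A; exact: advQ.
- by move=> z /andP[z0 _]; rewrite lee_fin ler0q.
- by rewrite nE.
rewrite nE qm muleC; congr (_ * _)%E; exact/esym/mass_box.
Qed.

Lemma integral_telescope_le Q : (forall t, (t < T)%N ->
  (\int[Q]_(D in Box) value t.+1 D <= \int[Q]_(D in Box) value t D)%E) ->
  (\int[Q]_(D in Box) value T D <= \int[Q]_(D in Box) value 0 D)%E.
Proof.
move=> step.
suff H t : (t <= T)%N ->
  (\int[Q]_(D in Box) value t D <= \int[Q]_(D in Box) value 0 D)%E.
  exact: H (leqnn T).
elim: t => [_|t IH tT]; first exact: lexx.
exact: le_trans (step t tT) (IH (ltnW tT)).
Qed.

Lemma integral_telescope_ge Q : (forall t, (t < T)%N ->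
  (\int[Q]_(D in Box) value t D <= \int[Q]_(D in Box) value t.+1 D)%E) ->
  (\int[Q]_(D in Box) value 0 D <= \int[Q]_(D in Box) value T D)%E.
Proof.
move=> step.
suff H t : (t <= T)%N ->
  (\int[Q]_(D in Box) value 0 D <= \int[Q]_(D in Box) value t D)%E.
  exact: H (leqnn T).
elim: t => [_|t IH tT]; first exact: lexx.
exact: le_trans (IH (ltnW tT)) (step t tT).
Qed.

Lemma integral_value0 Q : Q Box = 1%E ->
  (\int[Q]_(D in Box) value 0 D = cost_to_go R U b T x0 mu)%E.
Proof.
move=> Q1; have mT := @measurable_rat_tuple T.
rewrite (eq_integral (cst (cost_to_go R U b T x0 mu))).
  by rewrite integral_cst// [X in (_ * X)%E]Q1 mule1.
by move=> D _; rewrite /value /prefix_cost big_geq// rmorph0 add0e subn0.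
Qed.

Lemma integral_valueT Q : Q Box = 1%E ->
  (\int[Q]_(D in Box) value T D = expected_cost b pi Q)%E.
Proof.
move=> Q1; rewrite /expected_cost unlock (integral_box setT _ Q1) setTI.
by apply: eq_integral => D _; rewrite /value subnn adde0.
Qed.

End Verification.

(** * Laws with prescribed transitions *)

Section Extension.
Variables (R : realType) (n : nat).
Variables (P : probability (n.-tuple rat) R) (k : n.-tuple rat -> probability
  rat R).

(** One more coordinate, drawn from a kernel k; all measurability is trivial
because the space of rational tuples is discrete. *)
Definition extension (A : set (n.+1.-tuple rat)) : \bar R :=
  (\int[P]_d k d [set z | A (rcons_tuple d z)])%E.

Let extension0 : extension set0 = 0%E.
Proof.
by rewrite /extension (eq_integral (cst 0%E)) ?integral0// => d _;
  exact: measure0.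
Qed.

Let extension_ge0 A : (0 <= extension A)%E.
Proof. exact: integral_ge0. Qed.

Let extension_sigma_additive : semi_sigma_additive extension.
Proof.
move=> F mF tF mUF.
rewrite [X in _ --> X](_ : _ =
  \int[P]_d (\sum_(i <oo) k d [set z | F i (rcons_tuple d z)]))%E; last first.
  apply: eq_integral => d _; apply/esym/cvg_lim => //.
  apply: (@measure_semi_sigma_additive _ _ _ (k d)
    (fun i => [set z | F i (rcons_tuple d z)])) => //.
  by apply/trivIsetP => i j _ _ ij;
    move/trivIsetP : tF => /(_ i j Logic.I Logic.I ij);
     move=> /seteqP[FF _]; apply/seteqP; split=> // z Fz; exact: FF Fz.
apply/cvg_closeP; split.
  by apply: is_cvg_nneseries => i _ _; exact: integral_ge0.
rewrite closeE// integral_nneseries// => i.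
exact: (discrete_measurable_fun (@measurable_rat_tuple n)).
Qed.

HB.instance Definition _ := isMeasure.Build _ _ R extension
  extension0 extension_ge0 extension_sigma_additive.

Let extensionT : extension setT = 1%E.
Proof.
rewrite /extension (eq_integral (cst 1%E)); last by move=> d _;
  exact: probability_setT.
by rewrite integral_cst// mul1e; exact: probability_setT.
Qed.

HB.instance Definition _ := Measure_isProbability.Build _ _ _ extension
  extensionT.

Lemma extension_prefix (S : set (n.-tuple rat)) (A : set (n.+1.-tuple rat)) :
  (forall d z, A (rcons_tuple d z) <-> S d) -> extension A = P S.
Proof.
move=> AS; rewrite /extension -[RHS]mul1e -integral_cst;
  last exact: measurable_rat_tuple.
rewrite [RHS]integral_mkcond; apply: eq_integral => d _.
rewrite patchE; case: ifPn => [/set_mem Sd|/negP Sd].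
  rewrite (_ : [set z | _] = setT) ?probability_setT//.
  by apply/seteqP; split=> // z _; exact/AS.
rewrite (_ : [set z | _] = set0) ?measure0//.
by apply/seteqP; split=> // z /AS /mem_set.
Qed.

Lemma extension_last (d : n.-tuple rat) (A : set rat) :
  extension [set D | cylinder n d D /\ A (coord n.+1 D)] =
  (P [set d] * k d A)%E.
Proof.
have mT := @measurable_rat_tuple n.
rewrite muleC -integral_cst// integral_mkcond; apply: eq_integral => e _.
rewrite patchE; case: ifPn => [/set_mem ->|/negP ed].
  congr (k d _); apply/seteqP; split=> z;
    rewrite /cylinder /coord/= nth_rcons size_tuple ltnn eqxx.
    by case.
  by rewrite -cats1 take_size_cat ?size_tuple.
rewrite (_ : [set z | _] = set0) ?measure0//.
apply/seteqP; split=> // z [/= + _].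
rewrite /cylinder/= -cats1 take_size_cat ?size_tuple// => /val_inj ee.
by apply: ed; rewrite ee; exact: mem_set.
Qed.

End Extension.

(** A finite-horizon Ionescu-Tulcea theorem: coordinates are added one by
one. *)
Lemma markov_exists (R : realType) (k : nat -> seq rat -> probability rat R) (n
  : nat) :
  exists Q : probability (n.-tuple rat) R,
  forall t (d : t.-tuple rat) (A : set rat), (t < n)%N ->
    Q [set D | cylinder t d D /\ A (coord t.+1 D)] =
    (Q (cylinder t d) * k t d A)%E.
Proof.
elim: n => [|n [P HP]]; first by exists (\d_([tuple] : 0.-tuple rat)).
exists (extension P (fun d => k n d)) => t d A.
rewrite ltnS leq_eqVlt => /predU1P[tn|tn].
  subst t; apply: etrans (extension_last _ _ _ _) _; congr (_ * _)%E.
  apply/esym; apply: extension_prefix => e z; rewrite /cylinder/=.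
  by rewrite -cats1 take_size_cat ?size_tuple//; split=> [/val_inj|->].
apply: (@etrans _ _ (P [set D | cylinder t d D /\ A (coord t.+1 D)])).
  apply: extension_prefix => e z; rewrite /cylinder /coord/= -cats1.
  by rewrite takel_cat ?size_tuple 1?ltnW// nth_cat size_tuple tn.
rewrite HP//; congr (_ * _)%E; apply/esym; apply: extension_prefix => e z.
by rewrite /cylinder/= -cats1 takel_cat ?size_tuple// ltnW.
Qed.

(** * Martingale laws *)

Section Martingales.
Variables (R : realType) (U mu : rat) (T : nat).
Implicit Types (t : nat) (D : T.-tuple rat) (Q : probability (T.-tuple rat) R).
Local Notation Box := (box U T).
Local Notation "q %:RE" := (ratr q : R)%:E (at level 2, format "q %:RE").
Local Notation cyl := (@cylinder T).

Let mT := @measurable_rat_tuple T.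

Lemma coord_preimage_box t : (0 < t <= T)%N ->
  (@coordT T t @^-1` ratI U) `&` Box = Box.
Proof.
move=> tT; apply/seteqP; split=> [D []//|D bD]; split=> //; exact: bD.
Qed.

Lemma marginal_mean Q t : Q Box = 1%E -> (0 < t <= T)%N ->
  (\int[marginal Q t]_(q in ratI U) q%:RE = \int[Q]_(D in Box) (coord t
    D)%:RE)%E.
Proof.
move=> Q1 tT; rewrite /marginal /distribution ge0_integral_pushforward//.
  by rewrite -[in RHS](coord_preimage_box tT); exact: (integral_box _ _ Q1).
by move=> q /set_mem /andP[q0 _]; rewrite lee_fin ler0q.
Qed.

Lemma integral_coord_cyl Q t (d : seq rat) : (0 < t)%N ->
  (\int[Q]_(D in cyl t d `&` Box) (coord t D)%:RE =
   (coord t d)%:RE * Q (cyl t d `&` Box))%E.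
Proof.
move=> t0; rewrite -integral_cst//; apply: eq_integral => D /set_mem[<- _].
by rewrite coord_take// t0 leqnn.
Qed.

Lemma MAR_mean_preserving Q : MAR R U mu T Q ->
  Q Box = 1%E /\ mean_preserving U mu Q.
Proof.
case=> Q1 mart marg; split=> // -[|t] d tT bd.
  have -> : cyl 0 d `&` Box = Box.
    by apply/seteqP; split=> [D []//|D bD]; split=> //;
      rewrite /cylinder/= take0 (tuple0 d).
  rewrite [X in (_ * X)%E]Q1 mule1 -marginal_mean//.
  by have [] := marg 1%N tT.
have := mart t.+1 [set d] tT; rewrite /=.
rewrite (_ : [set D | _] = cyl t.+1 d); last first.
  by apply/seteqP; split=> [D [_ -> //]|D dD]; exists d.
by rewrite !(integral_box (cyl t.+1 d) _ Q1) integral_coord_cyl.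
Qed.

(** Integrals over an event of the past split over the prefixes it contains, so
the prefix-wise property is enough; constancy of the mean in t is the case of
the full event. *)
Lemma mean_preserving_MAR Q : (0 < T)%N -> Q Box = 1%E ->
  mean_preserving U mu Q -> MAR R U mu T Q.
Proof.
move=> T0 Q1 mQ.
have lastE s (e : seq rat) : (0 < s)%N -> last_demand mu s e = coord s e by
  case: s.
have mart : martingale Q.
  move=> t B /andP[t0 tT] E.
  rewrite !(integral_box E _ Q1).
  apply: (@integral_fibers R _ _ _ _ (seq rat) mT mT Q Q (E `&` Box) (E `&` Box)
    (fun D => take t D) (fun D => take t D)).
  - move=> D [_ bD]; rewrite lee_fin ler0q.
    by have /andP[] : ratI U (coord t.+1 D) by exact: bD.
  - move=> D [_ bD]; rewrite lee_fin ler0q.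
    by have /andP[] : ratI U (coord t D) by apply: bD; rewrite t0 ltnW.
  move=> e.
  have [->|/set0P[D [[[d Bd dD] bD] De]]] :=
      eqVneq (E `&` Box `&` [set D | take t D = e]) set0.
    by rewrite !integral_set0.
  have ed : e = d by rewrite -De.
  rewrite {}ed {e De}.
  have -> : E `&` Box `&` [set D | take t D = d] = cyl t d `&` Box.
    by apply/seteqP; split=> [D' [[_ ?] ?]|D' [? ?]]; split=> //; split=> //;
      exists d.
  rewrite integral_coord_cyl// mQ//; last exact: box_take (ltnW tT) bD dD.
  by rewrite lastE.
have mean t : (0 < t <= T)%N -> (\int[Q]_(D in Box) (coord t D)%:RE = mu%:RE)%E.
  elim: t => // t IH tT; case: t IH tT => [|t] IH tT.
    have := mQ 0%N [tuple] T0.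
    have -> : cyl 0 [tuple] `&` Box = Box.
      by apply/seteqP; split=> [D []//|D bD]; split=> //;
        rewrite /cylinder/= take0.
    rewrite [X in (_ * X)%E]Q1 mule1; apply.
    by move=> s; case: s.
  rewrite -IH ?(ltnW tT)//; have := mart t.+1 setT tT; rewrite /=.
  rewrite (_ : [set D | _] = setT); last first.
    apply/seteqP; split=> // D _.
    have et : size (take t.+1 D) == t.+1 by rewrite size_takel ?size_tuple//
      ltnW.
    by exists (Tuple et).
  by rewrite !(integral_box setT _ Q1) !setTI.
split=> // t tT; split; last by rewrite marginal_mean// mean.
have := mass_box (@coordT T t @^-1` ratI U) Q1.
by rewrite coord_preimage_box// Q1 => /esym.
Qed.

End Martingales.

(** * Saddle point *)

Lemma mul_cond (R : realType) (x y : \bar R) : x \is a fin_num ->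
  y \is a fin_num -> (0 < y)%E -> x = (y * (fine x / fine y)%:E)%E.
Proof.
case: x y => [x| |] [y| |]//= _ _; rewrite lte_fin => y0.
by rewrite -EFinM mulrC divfK// gt_eqF.
Qed.

Lemma mul_cond_inv (R : realType) (x y z : \bar R) : y \is a fin_num ->
  z \is a fin_num -> (0 < y)%E -> x = (y * z)%E -> fine x / fine y = fine z.
Proof.
case: y z => [y| |] [z| |]//= _ _; rewrite lte_fin => y0 -> /=.
by rewrite mulrAC divff ?mul1r// gt_eqF.
Qed.

Section Solution.
Variables (R : realType) (U b mu x0 : rat) (T : nat).
Hypotheses (U_gt0 : 0 < U) (b_gt0 : 0 < b) (T_ge1 : (1 <= T)%N).
Hypotheses (mu_in : ratI U mu) (x0_in : ratI U x0).
Implicit Types (t : nat) (D : T.-tuple rat) (Q : probability (T.-tuple rat) R).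
Local Notation Box := (box U T).
Local Notation cyl := (@cylinder T).
Local Notation opt := (opt_policy U b mu x0 T).
Local Notation v0 := (cost_to_go R U b T x0 mu).

Lemma opt_policyS t (d : seq rat) :
  opt t.+1 d =
  Num.max (stock x0 opt t d) (chi U b (T - t) (last_demand mu t d)).
Proof. by case: t => //=; rewrite subn0. Qed.

Lemma take_in_box t (d : t.+1.-tuple rat) : box U t.+1 d ->
  exists2 e : t.-tuple rat, box U t e & take t d = e :> seq rat.
Proof.
move=> bd; have et : size (take t d) == t by rewrite size_takel// size_tuple.
by exists (Tuple et) => //; exact: (@box_take U t.+1 t d (Tuple et)).
Qed.

Lemma opt_ratI t (d : t.-tuple rat) : (t < T)%N -> box U t d ->
  stock x0 opt t d <= U /\ ratI U (opt t.+1 d).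
Proof.
elim: t d => [|t IH] d tT bd.
  split; first by have /andP[] := x0_in.
  rewrite opt_policyS subn0 -(prednK T_ge1); apply: max_chi_ratI => //.
  by have /andP[] := x0_in.
have [e be de] := take_in_box bd.
have [_ /andP[_ oU]] := IH e (ltnW tT) be.
have dU : ratI U (coord t.+1 d) by apply: bd; rewrite leqnn.
have sU : stock x0 opt t.+1 d <= U.
  rewrite /stock de lerBlDr; apply: le_trans oU _.
  by rewrite lerDl; have /andP[] := dU.
split=> //; rewrite opt_policyS -(subnSK tT).
by apply: max_chi_ratI.
Qed.

Lemma Pi_steps (pi : policy) : Pi U x0 T pi <->
  forall t (d : t.-tuple rat), (t < T)%N -> box U t d ->
    stock x0 pi t d <= pi t.+1 d /\ ratI U (pi t.+1 d).
Proof.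
split=> [[[pi1 adm] piU] t d tT bd|H].
  split; last exact: piU.
  case: t d tT bd => [|t] d tT bd; first by rewrite (tuple0 d).
  exact: adm t.+2 d tT bd.
split; first split.
- have := H 0%N [tuple] T_ge1; case=> //.
  by case.
- move=> [//|[//|t]] d /andP[_ tT] bd; exact: (H t.+1 d tT bd).1.
- by move=> [//|t] d /andP[_ tT] bd; exact: (H t d tT bd).2.
Qed.

Lemma opt_in_Pi : Pi U x0 T opt.
Proof.
apply/Pi_steps => t d tT bd; split; last exact: (opt_ratI tT bd).2.
by rewrite opt_policyS le_max lexx.
Qed.

(** The expected [value] starts at V_T(x_0, mu), ends at the expected total
cost, and does not increase. *)
Lemma opt_guarantee Q : MAR R U mu T Q -> (expected_cost b opt Q <= v0)%E.
Proof.
move=> /MAR_mean_preserving[Q1 mQ].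
rewrite -(integral_valueT b mu x0 opt Q1) -(integral_value0 b mu x0 opt Q1).
apply: integral_telescope_le => t tT.
apply: value_step_le => // d bd; split; first exact: (opt_ratI tT bd).1.
exact: opt_policyS.
Qed.

Lemma adversary_guarantee (pi : policy) Q : Pi U x0 T pi ->
  adversarial U b mu pi Q ->
  MAR R U mu T Q /\ (v0 <= expected_cost b pi Q)%E.
Proof.
move=> /Pi_steps piP advQ.
have piU t (d : t.-tuple rat) : (t < T)%N -> box U t d -> ratI U (pi t.+1 d).
  by move=> tT bd; exact: (piP t d tT bd).2.
have Q1 := adversarial_box U_gt0 b_gt0 mu_in piU advQ.
split; first exact: mean_preserving_MAR (adversarial_mean _ _ _ piU advQ).
rewrite -(integral_valueT b mu x0 pi Q1) -(integral_value0 b mu x0 pi Q1).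
apply: integral_telescope_ge => t tT.
by apply: value_step_ge => // d bd; exact: (piP t d tT bd).1.
Qed.

Lemma adversary_exists (pi : policy) :
  exists Q : probability (T.-tuple rat) R, adversarial U b mu pi Q.
Proof.
have [Q HQ] := @markov_exists R
  (fun t d => qlaw R U b (T - t) (pi t.+1 d) (last_demand mu t d)) T.
by exists Q.
Qed.

Lemma worst_cost_ge (pi : policy) : Pi U x0 T pi ->
  (v0 <= worst_cost R U b mu T pi)%E.
Proof.
move=> piP; have [Q advQ] := adversary_exists pi.
have [QM vQ] := adversary_guarantee piP advQ.
by apply: le_trans vQ _; apply: ereal_sup_ubound; exists Q.
Qed.

Lemma worst_cost_opt : (worst_cost R U b mu T opt <= v0)%E.
Proof. by apply: ge_ereal_sup => _ [Q QM <-]; exact: opt_guarantee. Qed.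

Lemma P_valueE : P_value R U b mu x0 T = v0.
Proof.
apply/le_anti/andP; split; last first.
  by apply: le_ereal_inf_tmp => _ [pi piP <-]; exact: worst_cost_ge.
apply: le_trans worst_cost_opt; apply: ereal_inf_lbound.
by exists opt => //; exact: opt_in_Pi.
Qed.

(** The specification by conditional laws says nothing about prefixes of mass
zero, where the product form holds trivially. *)
Lemma worst_case_specE Q :
  worst_case_spec U b mu x0 Q <-> adversarial U b mu opt Q.
Proof.
have mT := @measurable_rat_tuple T.
have cyl0 (d : 0.-tuple rat) : cyl 0 d = setT.
  by apply/seteqP; split=> // D _; rewrite /cylinder/= take0 (tuple0 d).
split=> [[spec1 spec] t d A tT|advQ].
  case: t d tT => [|t] d tT.
    rewrite cyl0 [X in (X * _)%E]probability_setT mul1e subn0 (tuple0 d).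
    rewrite -spec1; congr (Q _).
    by apply/seteqP; split=> D //= [].
  have [dpos|/negP] := pselect (supp T Q t.+1 d).
    rewrite -(spec t.+1 d tT dpos A) /cond_law.
    by apply: mul_cond dpos; apply: fin_num_measure; exact: mT.
  rewrite -leNgt measure_le0 => /eqP d0; rewrite [X in (X * _)%E]d0 mul0e.
  apply/eqP; rewrite -measure_le0 -d0; apply: le_measure; rewrite ?inE//.
  by move=> D [].
split=> [A|t d /andP[t0 tT] dpos A].
  have := advQ 0%N [tuple] A T_ge1.
  rewrite cyl0 [X in (X * _)%E]probability_setT mul1e subn0 => <-.
  by congr (Q _); apply/seteqP; split=> D //=; case.
have lastE (e : seq rat) : last_demand mu t e = coord t e by case: (t) t0.
rewrite /cond_law -lastE -(fineK (fin_num_measure (qlaw _ _ _ _ _ _) A _))//;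
  congr EFin.
apply: (mul_cond_inv _ _ dpos _).
- by apply: fin_num_measure; exact: mT.
- exact: fin_num_measure.
- exact: advQ t d A tT.
Qed.

End Solution.

Theorem theorem3 (R : realType) (U b : rat) (T : nat) (mu x0 : rat)
    (U_gt0 : 0 < U) (b_gt0 : 0 < b) (T_ge1 : (1 <= T)%N)
    (mu_in : ratI U mu) (x0_in : ratI U x0) :
  [/\
    (forall (t : nat) (x d : rat), (1 <= t <= T)%N -> ratI U x -> ratI U d ->
       Phihat R U b t x d (Num.max x (chi U b t d))) /\
    argmin_set (Pi U x0 T) (worst_cost R U b mu T) (opt_policy U b mu x0 T),

    (forall (t : nat) (x d : rat), (1 <= t <= T)%N -> ratI U x -> ratI U d ->
       Qhat R U b t x d (qlaw R U b t x d)) /\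
    (exists Q : probability (T.-tuple rat) R, worst_case_spec U b mu x0 Q) /\
    (forall Q : probability (T.-tuple rat) R, worst_case_spec U b mu x0 Q ->
       argmax_set (MAR R U mu T)
         (expected_cost b (opt_policy U b mu x0 T)) Q) &

    x0 <= chi U b T mu ->
    P_value R U b mu x0 T = (ratr (Opt U b T mu) : R)%:E].
Proof.
split; first split.
- move=> [//|n] x d _ xU dU; have /andP[_ xtop] := xU; split.
    by split; [rewrite le_max lexx | exact: max_chi_ratI].
  by move=> w [xw wU]; exact: chi_optimal.
- split; first exact: opt_in_Pi.
  move=> pi piP; apply: le_trans (worst_cost_ge _ _ _ _ _ piP) => //.
  exact: worst_cost_opt.
- split=> [[//|n] x d _ xU dU|].
    have [v [qM vq gv]] := qlaw_optimal R U_gt0 b_gt0 n xU dU.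
    split=> // Q QM; apply: le_trans vq; apply: le_trans gv.
    exact: ghat_ge_integral.
  have specE := @worst_case_specE R U b mu x0 T T_ge1.
  split.
    have [Q advQ] := adversary_exists R U b mu T (opt_policy U b mu x0 T).
    by exists Q; apply/specE.
  move=> Q /specE advQ.
  have [QM vQ] := adversary_guarantee U_gt0 b_gt0 T_ge1 mu_in
    (opt_in_Pi U_gt0 b_gt0 T_ge1 mu_in x0_in) advQ.
  split=> // Q' QM'; apply: le_trans vQ.
  exact: opt_guarantee.
move=> xchi; rewrite P_valueE//.
case: T T_ge1 xchi => // n _ xchi; have /andP[_ xtop] := x0_in.
by rewrite /cost_to_go V_max_chi// max_r// ghat_chi.
Qed.
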